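(* Let $\kappa$ be a positive integer, $\gamma$ an entire function of the form $\gamma(z)=\sum_{n=0}^\infty a_nz^n$ ($z\in\mathbb{C}$) with $a_n\ge0$ for all $n$ and $a_k>0$ for some $k\ge1$, $\|\cdot\|$ a norm on $\mathbb{R}^\kappa$ induced by an inner product, and $\mu_\gamma$ the Borel measure on $\mathbb{R}^\kappa$ given by $\mu_\gamma(\mathrm{d}x)=\gamma(\|x\|^2)\,\omega_\kappa(\mathrm{d}x)$, where $\omega_\kappa$ is $\kappa$-dimensional Lebesgue measure. Let $A$ be an invertible linear transformation of $\mathbb{R}^\kappa$. If $A$ is normal in $(\mathbb{R}^\kappa,\|\cdot\|)$ (i.e. $AA^*=A^*A$, the adjoint taken with respect to the inner product inducing $\|\cdot\|$), then the composition operator $C_A$ in $L^2(\mu_\gamma)$, given by $\mathcal{D}(C_A)=\{f\in L^2(\mu_\gamma):f\circ A\in L^2(\mu_\gamma)\}$, $C_Af=f\circ A$, is subnormal.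
   Context: A densely defined operator $S$ in a Hilbert space $\mathcal{H}$ is subnormal if there exist a Hilbert space $\mathcal{K}\supseteq\mathcal{H}$ (isometric embedding) and a normal operator $N$ in $\mathcal{K}$ with $\mathcal{D}(S)\subseteq\mathcal{D}(N)$ and $Sf=Nf$ for all $f\in\mathcal{D}(S)$. (For invertible $A$, $C_A$ is well defined and densely defined.) *)

(* Defs.v *)
From HB Require Import structures.
From mathcomp Require Import all_boot all_order all_algebra.
From mathcomp Require Import all_classical all_reals all_analysis.
From mathcomp Require Import complex.
Set Implicit Arguments. Unset Strict Implicit. Unset Printing Implicit Defensive.
Import Order.TTheory GRing.Theory Num.Theory.
Import numFieldNormedType.Exports.
Local Open Scope classical_set_scope.
Local Open Scope ring_scope.

(* R^kappa is represented by kappa.-tuple R, with its product sigma-algebra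
   (generated by the coordinate maps), which is the Borel sigma-algebra. *)
Definition vec (R : realType) (k : nat) := k.-tuple R.

(* Action of a matrix (linear transformation) on R^k. *)
Definition mxact (R : realType) (k : nat) (A : 'M[R]_k) (x : k.-tuple R)
  : k.-tuple R := [tuple \sum_(j < k) A i j * tnth x j | i < k].

(* Bilinear form with Gram matrix G: <x,y>_G = sum_ij x_i G_ij y_j. *)
Definition ipG (R : realType) (k : nat) (G : 'M[R]_k) (x y : k.-tuple R) : R :=
  \sum_(i < k) \sum_(j < k) tnth x i * G i j * tnth y j.

(* G is the Gram matrix of an inner product on R^k (symmetric, pos. definite).
   Every inner product on R^k is of this form. *)
Definition is_inner_product (R : realType) (k : nat) (G : 'M[R]_k) : Prop :=
  (forall i j, G i j = G j i) /\
  (forall x : k.-tuple R, x != [tuple 0 | _ < k] -> 0 < ipG G x x).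

(* The squared norm induced by the inner product G. *)
Definition normG2 (R : realType) (k : nat) (G : 'M[R]_k) (x : k.-tuple R) : R :=
  ipG G x x.

(* A is normal in (R^k, <.,.>_G): its G-adjoint B commutes with A. *)
Definition mx_normal (R : realType) (k : nat) (G : 'M[R]_k) (A : 'M[R]_k) : Prop :=
  exists B : 'M[R]_k,
    (forall x y, ipG G (mxact A x) y = ipG G x (mxact B y)) /\ A *m B = B *m A.

(* The k-dimensional Lebesgue measure: the measure on the product
   sigma-algebra of R^k giving every box its volume (unique such measure). *)
Definition is_lebesgue_k (R : realType) (k : nat)
  (w : {measure set (k.-tuple R) -> \bar R}) : Prop :=
  forall a b : k.-tuple R, (forall i, tnth a i <= tnth b i) ->
    w [set x | forall i, tnth a i <= tnth x i <= tnth b i] =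
    (\prod_(i < k) (tnth b i - tnth a i))%:E.

(* gamma(t) = sum_n a_n t^n (for real t) *)
Definition gammaR (R : realType) (a : nat -> R) (t : R) : R :=
  limn (series (fun n => a n * t ^+ n)).

(* mu is the measure gamma(|x|^2) w(dx) *)
Definition is_density_measure (R : realType) (k : nat) (G : 'M[R]_k) (a : nat -> R)
  (w mu : {measure set (k.-tuple R) -> \bar R}) : Prop :=
  forall E, measurable E ->
    (mu E = \int[w]_(x in E) (gammaR a (normG2 G x))%:E)%E.

(* ---------- complex L^2(mu) ---------- *)
Local Notation C R := (complex R).

Definition cabs2 (R : realType) (z : C R) : R := (@complex.Re R z) ^+ 2 + (@complex.Im R z) ^+ 2.

(* f is (a representative of) an element of L^2(mu) *)
Definition L2 (R : realType) (k : nat) (mu : {measure set (k.-tuple R) -> \bar R})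
  (f : k.-tuple R -> C R) : Prop :=
  measurable_fun setT (fun x => @complex.Re R (f x)) /\
  measurable_fun setT (fun x => @complex.Im R (f x)) /\
  (\int[mu]_x (cabs2 (f x))%:E < +oo)%E.

Definition L2norm2 (R : realType) (k : nat) (mu : {measure set (k.-tuple R) -> \bar R})
  (f : k.-tuple R -> C R) : \bar R := \int[mu]_x (cabs2 (f x))%:E.

(* Domain of the composition operator C_A in L^2(mu). *)
Definition dom_CA (R : realType) (k : nat) (mu : {measure set (k.-tuple R) -> \bar R})
  (A : 'M[R]_k) (f : k.-tuple R -> C R) : Prop :=
  L2 mu f /\ L2 mu (f \o mxact A).

(* ---------- abstract complex Hilbert spaces ---------- *)
Definition hnorm2 (R : realType) (K : lmodType (C R)) (ip : K -> K -> C R) (x : K) : R :=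
  @complex.Re R (ip x x).

Definition is_hilbert (R : realType) (K : lmodType (C R)) (ip : K -> K -> C R) : Prop :=
  (forall (c : C R) (x y z : K), ip (c *: x + y) z = c * ip x z + ip y z) /\
  (forall x y : K, ip y x = (ip x y)^*) /\
  (forall x : K, 0 <= ip x x) /\
  (forall x : K, ip x x = 0 -> x = 0) /\
  (* completeness *)
  (forall u : nat -> K,
     (forall e : R, 0 < e -> exists N, forall m n, (N <= m)%N -> (N <= n)%N ->
        hnorm2 ip (u m - u n) < e) ->
     exists l : K, forall e : R, 0 < e -> exists N, forall n, (N <= n)%N ->
        hnorm2 ip (u n - l) < e).

(* z is adj(N) y (graph of the Hilbert-space adjoint of (N, D)) *)
Definition adj_rel (R : realType) (K : lmodType (C R)) (ip : K -> K -> C R)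
  (D : set K) (N : K -> K) (y z : K) : Prop :=
  forall x, D x -> ip (N x) y = ip x z.

(* (N, D) is a (possibly unbounded) normal operator in K:
   linear, densely defined, closed, and adj(N) N = N adj(N). *)
Definition normal_op (R : realType) (K : lmodType (C R)) (ip : K -> K -> C R)
  (D : set K) (N : K -> K) : Prop :=
  (* linear subspace domain, linear operator *)
  D 0 /\
  (forall (c : C R) x y, D x -> D y -> D (c *: x + y) /\ N (c *: x + y) = c *: N x + N y) /\
  (* densely defined *)
  (forall x e, 0 < e -> exists y, D y /\ hnorm2 ip (x - y) < e) /\
  (* closed *)
  (forall (u : nat -> K) x y, (forall n, D (u n)) ->
     (forall e, 0 < e -> exists M, forall n, (M <= n)%N -> hnorm2 ip (u n - x) < e) ->
     (forall e, 0 < e -> exists M, forall n, (M <= n)%N -> hnorm2 ip (N (u n) - y) < e) ->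
     D x /\ N x = y) /\
  (* equal domains of adj(N) N and N adj(N) *)
  (forall x, (D x /\ exists w, adj_rel ip D N (N x) w) <->
             (exists z, adj_rel ip D N x z /\ D z)) /\
  (* equal values of adj(N) N and N adj(N) *)
  (forall x w z, D x -> adj_rel ip D N (N x) w -> adj_rel ip D N x z -> D z ->
     w = N z).

(* C_A in L^2(mu) is subnormal: there is a Hilbert space K, an isometric
   (complex-linear) embedding V of L^2(mu) into K, and a normal operator N in K
   extending V C_A V^{-1}. *)
Definition CA_subnormal (R : realType) (k : nat)
  (mu : {measure set (k.-tuple R) -> \bar R}) (A : 'M[R]_k) : Prop :=
  exists (K : lmodType (C R)) (ip : K -> K -> C R) (V : (k.-tuple R -> C R) -> K)
         (D : set K) (N : K -> K),
    is_hilbert ip /\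
    (forall (c : C R) f g, L2 mu f -> L2 mu g ->
       V (fun x => c * f x + g x) = c *: V f + V g) /\
    (forall f, L2 mu f -> (hnorm2 ip (V f))%:E = L2norm2 mu f) /\
    normal_op ip D N /\
    (forall f, dom_CA mu A f -> D (V f) /\ N (V f) = V (f \o mxact A)).

(* Main.v *)
Require Import Defs.
From HB Require Import structures.
From mathcomp Require Import all_boot all_order all_algebra.
From mathcomp Require Import all_classical all_reals all_analysis.
From mathcomp Require Import complex.
From mathcomp Require Import measurable_realfun ring lra zify.
Import Order.TTheory GRing.Theory Num.Theory.
Import numFieldNormedType.Exports.
Local Open Scope classical_set_scope.
Local Open Scope ring_scope.

(** The spectral theorem gives quadratic forms q_j >= 0 with
    |x|^2 = sum_j q_j(x) and q_j(A x) = c_j q_j(x), c_j > 0. Expanding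
    gamma(|x|^2) = sum_n a_n (sum_j q_j(x))^n over words s in the indices j
    writes the density of mu as a countable sum of weights W_s >= 0 with
    W_s(A x) = C_s W_s(x). Hence f |-> (sqrt(W_s) f)_s embeds L^2(mu)
    isometrically into the sum of countably many copies of L^2(R^k), and there
    C_A is extended by the operator acting on the s-th copy as
    F |-> C_s^(-1/2) (F o A). Lebesgue measure being multiplied by a constant
    under A, each summand is a positive multiple of one and the same multiple
    of a unitary, and their (unbounded) direct sum is normal. *)

(** The factor C_s^(-1/2) is forced by intertwining: sqrt(W_s(x)) f(A x) has to equal C_s^(-1/2)
    sqrt(W_s(A x)) f(A x). Words are used instead of multi-indices because each word occurs exactly
    once in the expansion of a power. The C_s may accumulate at 0, so the extension N is in general
    unbounded and its adjoint has to be found together with its domain. This is possible because the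
    weight b = C_s^(-1/2) is constant on each copy, hence invariant under the map: the adjoint is
    again a weighted composition operator, with the inverse map, weight r b and the same domain,
    where w(A^-1 E) = r w(E). Both adj(N) N and N adj(N) are then multiplication by r b^2. The
    existence of r comes from the uniqueness of translation-invariant measures, since the hypothesis
    on w fixes its values on boxes only. *)

Set Implicit Arguments. Unset Strict Implicit. Unset Printing Implicit Defensive.

(** * Complex numbers *)

Lemma Re_sum (R : realType) (I : Type) (r : seq I) (P : pred I) (F : I -> complex R) :
  complex.Re (\sum_(i <- r | P i) F i) = \sum_(i <- r | P i) complex.Re (F i).
Proof. by apply: big_morph => // -[? ?] []. Qed.

Lemma Im_sum (R : realType) (I : Type) (r : seq I) (P : pred I) (F : I -> complex R) :
  complex.Im (\sum_(i <- r | P i) F i) = \sum_(i <- r | P i) complex.Im (F i).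
Proof. by apply: big_morph => // -[? ?] []. Qed.

Lemma ReD (R : realType) (x y : complex R) :
  complex.Re (x + y) = complex.Re x + complex.Re y.
Proof. by case: x => ? ?; case: y. Qed.

Lemma ImD (R : realType) (x y : complex R) :
  complex.Im (x + y) = complex.Im x + complex.Im y.
Proof. by case: x => ? ?; case: y. Qed.

Lemma ReM (R : realType) (x y : complex R) :
  complex.Re (x * y) = complex.Re x * complex.Re y - complex.Im x * complex.Im y.
Proof. by case: x => ? ?; case: y. Qed.

Lemma ImM (R : realType) (x y : complex R) :
  complex.Im (x * y) = complex.Re x * complex.Im y + complex.Im x * complex.Re y.
Proof. by case: x => ? ?; case: y. Qed.

Lemma Re_conj (R : realType) (x : complex R) : complex.Re x^* = complex.Re x.
Proof. by case: x. Qed.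

Lemma Im_conj (R : realType) (x : complex R) : complex.Im x^* = - complex.Im x.
Proof. by case: x. Qed.

Lemma conj_real (R : realType) (s : R) : (s%:C%C)^* = s%:C%C :> complex R.
Proof. by apply/eqP; rewrite eq_complex Re_conj Im_conj /= oppr0 !eqxx. Qed.

(** * Diagonalization of a normal matrix *)

Local Open Scope sesquilinear_scope.

Lemma real_complex_mxCt (R : realType) (m n : nat) (M : 'M[R]_(m, n)) :
  (map_mx (real_complex R) M) ^t* = map_mx (real_complex R) M^T :> 'M[complex R]_(n, m).
Proof.
by apply/matrixP => i j; rewrite !mxE; apply/eqP; rewrite eq_complex /= oppr0 !eqxx.
Qed.

(** With v = a + i b the value is ipG(a, a) + ipG(b, b), the cross terms cancelling by symmetry of
    [G]. Positivity thus passes to the complex space in which the spectral theorem is applied. *)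
Lemma complex_posdef (R : realType) (k : nat) (G : 'M[R]_k) (v : 'rV[complex R]_k) :
  is_inner_product G -> v != 0 ->
  0 < (v *m map_mx (real_complex R) G *m v ^t*) 0 0.
Proof.
move=> [Gsym Gpos] v0.
pose a := [tuple complex.Re (v 0 i) | i < k].
pose b := [tuple complex.Im (v 0 i) | i < k].
have -> : (v *m map_mx (real_complex R) G *m v ^t*) 0 0 =
    (ipG G a a + ipG G b b)%:C%C.
  rewrite mxE; under eq_bigr do rewrite !mxE big_distrl /=.
  rewrite exchange_big /=; apply/eqP; rewrite eq_complex /=.
  rewrite Re_sum Im_sum; apply/andP; split; apply/eqP.
    rewrite /ipG -big_split /=; apply: eq_bigr => i _.
    rewrite Re_sum -big_split /=; apply: eq_bigr => j _.
    by rewrite !mxE !tnth_mktuple !(ReM, ImM, Re_conj, Im_conj) /=; ring.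
  under eq_bigr => i _ do (rewrite Im_sum; under eq_bigr => j _ do
    rewrite !mxE !(ReM, ImM, Re_conj, Im_conj) /=).
  (* Exchanging the two summation indices turns the imaginary part into its own negative. *)
  set s := (LHS); suff : s = - s by move/eqP; rewrite -addr_eq0 -mulr2n mulrn_eq0 /= => /eqP.
  rewrite {1}/s exchange_big /= /s -sumrN; apply: eq_bigr => i _.
  by rewrite -sumrN; apply: eq_bigr => j _; rewrite (Gsym j i); ring.
rewrite ltcR; have ge0 x : 0 <= ipG G x x.
  have [->|/Gpos/ltW//] := eqVneq x [tuple 0 | _ < k].
  by rewrite /ipG big1 // => i _; rewrite big1 // => j _; rewrite !tnth_mktuple !mul0r.
have [a0|/Gpos agt] := eqVneq a [tuple 0 | _ < k]; last by rewrite ltr_pwDl.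
have [b0|/Gpos bgt] := eqVneq b [tuple 0 | _ < k]; last by rewrite ltr_wpDl.
case/eqP: v0; apply/rowP => i; rewrite mxE; apply/eqP; rewrite eq_complex /=.
have := congr1 (fun t => tnth t i) a0; have := congr1 (fun t => tnth t i) b0.
by rewrite !tnth_mktuple => -> ->; rewrite !eqxx.
Qed.

(** [S] changes coordinates so that [G] becomes the standard Hermitian form. It is sqrt(D) P for a
    unitary diagonalization of [G]; each eigenvalue is the value of the form at a row of P, hence
    positive. *)
Lemma posdef_factor (R : realType) (k : nat) (G : 'M[R]_k) : is_inner_product G ->
  exists2 S : 'M[complex R]_k, S \in unitmx & S ^t* *m S = map_mx (real_complex R) G.
Proof.
move=> Gip; set GC := map_mx _ G.
have GCt : GC ^t* = GC.
  by rewrite real_complex_mxCt; congr map_mx; apply/matrixP => i j; rewrite mxE (proj1 Gip).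
have GCn : GC \is normalmx by apply/normalmxP; rewrite GCt.
have /orthomx_spectralP := GCn.
set P := spectralmx GC; set D := spectral_diag GC => GE.
have Pu : P \is unitarymx by exact: spectral_unitarymx.
have Punit : P \in unitmx by exact: unitarymx_unit.
rewrite invmx_unitary // in GE.
have DE : diag_mx D = P *m GC *m P ^t*.
  rewrite GE !mulmxA; have /unitarymxP -> := Pu.
  by rewrite mul1mx -mulmxA; have /unitarymxP -> := Pu; rewrite mulmx1.
have Dpos j : 0 < D 0 j.
  have := @complex_posdef R k G (row j P) Gip; rewrite -/GC.
  have -> : (row j P *m GC *m (row j P) ^t*) 0 0 = D 0 j.
    transitivity ((P *m GC *m P ^t*) j j); last by rewrite -DE mxE eqxx mulr1n.
    rewrite -row_mul !mxE; apply: eq_bigr => i _; by rewrite !mxE.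
  apply; apply/eqP => rj0.
  have := mulmxK Punit (delta_mx 0 j : 'rV_k); rewrite -rowE rj0 mul0mx => /rowP/(_ j).
  by rewrite !mxE !eqxx => /esym/eqP; rewrite oner_eq0.
pose d := \row_j sqrtC (D 0 j).
exists (diag_mx d *m P).
  rewrite unitmx_mul Punit andbT unitmxE det_diag unitfE prodf_seq_neq0.
  by apply/allP => i _ /=; rewrite mxE sqrtC_eq0 gt_eqF.
rewrite trmx_mul map_mxM -mulmxA (mulmxA _ (diag_mx d)) tr_diag_mx map_diag_mx mulmx_diag.
rewrite GE -mulmxA; congr (_ *m (diag_mx _ *m _)); apply/rowP => i; rewrite !mxE.
have sE : (sqrtC (D 0 i))^* = sqrtC (D 0 i).
  by apply/CrealP/ger0_real; rewrite sqrtC_ge0 ltW.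
by rewrite -[RHS]sqrtCK expr2; congr (_ * _).
Qed.

(** In the coordinates of [S] the [G]-adjoint is the conjugate transpose, so A' = S A S^-1 is normal
    in the ordinary sense and a unitary Q diagonalizes it. T = Q S still factors [G] because Q is
    unitary. *)
Lemma normal_diag (R : realType) (k : nat) (G A : 'M[R]_k) :
  is_inner_product G -> mx_normal G A ->
  exists T : 'M[complex R]_k, exists lam : 'rV[complex R]_k,
    [/\ T \in unitmx, T ^t* *m T = map_mx (real_complex R) G &
        T *m map_mx (real_complex R) A = diag_mx lam *m T].
Proof.
move=> Gip [B [adjB AB]].
have [S Su SG] := posdef_factor Gip.
(* The adjoint relation, evaluated at pairs of standard basis vectors. *)
have GB : A^T *m G = G *m B.
  apply/matrixP => i j.
  have ipE (M N : 'M[R]_k) : ipG M (mxact N [tuple (l == i)%:R | l < k])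
      [tuple (l == j)%:R | l < k] = (N^T *m M) i j.
    rewrite /ipG exchange_big (bigD1 j) //= [X in _ + X]big1 ?addr0; last first.
      move=> l lj; rewrite big1 // => m _.
      by rewrite !tnth_mktuple (negbTE lj) mulr0.
    rewrite mxE; apply: eq_bigr => l _; rewrite !tnth_mktuple eqxx mulr1 mxE.
    congr (_ * _); rewrite (bigD1 i) //= !tnth_mktuple eqxx mulr1 big1 ?addr0 //.
    by move=> m mi; rewrite !tnth_mktuple (negbTE mi) mulr0.
  have ipE' (M N : 'M[R]_k) : ipG M [tuple (l == i)%:R | l < k]
      (mxact N [tuple (l == j)%:R | l < k]) = (M *m N) i j.
    rewrite /ipG (bigD1 i) //= [X in _ + X]big1 ?addr0; last first.
      move=> l lj; rewrite big1 // => m _.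
      by rewrite !tnth_mktuple (negbTE lj) !mul0r.
    rewrite mxE; apply: eq_bigr => l _; rewrite !tnth_mktuple eqxx mul1r.
    congr (_ * _); rewrite (bigD1 j) //= !tnth_mktuple eqxx mulr1 big1 ?addr0 //.
    by move=> m mi; rewrite !tnth_mktuple (negbTE mi) mulr0.
  by rewrite -ipE adjB ipE'.
pose toC m n := @map_mx _ _ (real_complex R) m n.
pose A' := S *m toC _ _ A *m invmx S.
have A't : A' ^t* = S *m toC _ _ B *m invmx S.
  have GBC : toC _ _ A^T *m (S ^t* *m S) = (S ^t* *m S) *m toC _ _ B.
    by rewrite SG /toC -!map_mxM GB.
  have Stu : S ^t* \in unitmx by rewrite map_unitmx unitmx_tr.
  rewrite /A' trmx_mul map_mxM trmx_mul map_mxM real_complex_mxCt.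
  apply: (canRL (mulmxK Su)).
  have -> : (invmx S) ^t* = invmx (S ^t*) by rewrite trmx_inv map_invmx.
  by rewrite -!mulmxA GBC -!mulmxA mulKmx.
have A'n : A' \is normalmx.
  apply/normalmxP; rewrite A't /A'.
  rewrite !mulmxA mulmxKV // mulmxKV // -!(mulmxA S).
  by rewrite /toC -!map_mxM AB.
have /orthomx_spectralP := A'n.
set Q := spectralmx A'; set D := spectral_diag A' => A'E.
have Qu : Q \is unitarymx by exact: spectral_unitarymx.
have Qunit : Q \in unitmx by exact: unitarymx_unit.
exists (Q *m S), D; split.
- by rewrite unitmx_mul Qunit.
- rewrite trmx_mul map_mxM -mulmxA (mulmxA _ Q) -(invmx_unitary Qu) mulVmx //.
  by rewrite mul1mx.
- have : A' *m S = S *m toC _ _ A by rewrite /A' mulmxKV.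
  by move=> A'S; rewrite -mulmxA -A'S A'E !mulmxA mulmxV // mul1mx.
Qed.

(** In eigencoordinates q_j(x) = |(T x)_j|^2 and c_j = |lam_j|^2. The factorization of [G] by T
    makes the q_j add up to the squared norm. Positivity of c_j: lam_j = 0 would annihilate row j of
    the invertible matrix T A. *)
Lemma normal_forms (R : realType) (k : nat) (G A : 'M[R]_k) :
  is_inner_product G -> A \in unitmx -> mx_normal G A ->
  exists q : 'I_k -> k.-tuple R -> R, exists c : 'I_k -> R,
    [/\ forall j, 0 < c j, forall j x, 0 <= q j x,
        forall j, measurable_fun setT (q j),
        forall x, \sum_j q j x = normG2 G x &
        forall j x, q j (mxact A x) = c j * q j x].
Proof.
move=> Gip Au An; have [T [lam [Tu TG TA]]] := normal_diag Gip An.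
pose y (x : k.-tuple R) : 'cV[complex R]_k := \col_i (tnth x i)%:C%C.
exists (fun j x => cabs2 ((T *m y x) j 0)), (fun j => cabs2 (lam 0 j)).
have cabs2_ge0 z : 0 <= @cabs2 R z by rewrite addr_ge0 // sqr_ge0.
have cabs2M z t : @cabs2 R (z * t) = cabs2 z * cabs2 t.
  by rewrite /cabs2 ReM ImM; ring.
split=> //.
- move=> j; rewrite lt_neqAle cabs2_ge0 andbT eq_sym; apply/eqP => lam0.
  have {}lam0 : lam 0 j = 0.
    apply/eqP; rewrite eq_complex /=; move/eqP: lam0.
    by rewrite /cabs2 paddr_eq0 ?sqr_ge0 // !sqrf_eq0.
  have AuC : map_mx (real_complex R) A \in unitmx by rewrite map_unitmx.
  have : row j (T *m map_mx (real_complex R) A) = 0.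
    by rewrite TA row_mul row_diag_mx lam0 scale0r mul0mx.
  rewrite rowE => /(congr1 (mulmx^~ (invmx (T *m map_mx (real_complex R) A)))).
  rewrite mulmxK ?unitmx_mul ?Tu // mul0mx => /rowP/(_ j).
  by rewrite !mxE !eqxx => /eqP; rewrite oner_eq0.
- move=> j; rewrite /cabs2.
  have m1 (f : complex R -> R) (F : 'I_k -> R) : (forall x, f ((T *m y x) j 0) =
      \sum_i F i * tnth x i) -> measurable_fun setT (fun x : k.-tuple R => f ((T *m y x) j 0)).
    move=> fE; under eq_fun do rewrite fE.
    apply: measurable_sum => i; apply: measurable_funM => //; exact: measurable_tnth.
  apply: measurable_funD; apply: measurable_funX.
    apply: (m1 _ (fun i => complex.Re (T j i))) => x; rewrite mxE Re_sum.
    by apply: eq_bigr => i _; rewrite mxE ReM /= mulr0 subr0.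
  apply: (m1 _ (fun i => complex.Im (T j i))) => x; rewrite mxE Im_sum.
  by apply: eq_bigr => i _; rewrite mxE ImM /= mulr0 add0r.
- move=> x; apply: complexI.
  have -> : (normG2 G x)%:C%C = ((y x) ^t* *m map_mx (real_complex R) G *m y x) 0 0.
    rewrite mxE /normG2 /ipG exchange_big rmorph_sum; apply: eq_bigr => i _.
    rewrite rmorph_sum !mxE big_distrl; apply: eq_bigr => l _.
    rewrite !mxE !rmorphM; congr (_ * _ * _).
    by apply/eqP; rewrite eq_complex /= oppr0 !eqxx.
  rewrite -TG mulmxA -map_mxM -trmx_mul -mulmxA mxE rmorph_sum.
  apply: eq_bigr => j _; apply: etrans (_ : ((T *m y x) j 0)^* * (T *m y x) j 0 = _).
    by rewrite mulrC -normCK -add_Re2_Im2.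
  by rewrite !mxE.
- move=> j x; rewrite -cabs2M; congr cabs2.
  have -> : y (mxact A x) = map_mx (real_complex R) A *m y x.
    apply/colP => i; rewrite !mxE tnth_mktuple rmorph_sum; apply: eq_bigr => l _.
    by rewrite !mxE rmorphM.
  by rewrite mulmxA TA -mulmxA mul_diag_mx mxE.
Qed.

Local Close Scope sesquilinear_scope.

(** * Lebesgue measure under a linear map *)

Section pushforward_measure.
Context (d d' : measure_display) (T : measurableType d) (T' : measurableType d')
  (R : realType) (m : {measure set T -> \bar R}) (f : T -> T').
Hypothesis mf : measurable_fun setT f.

Let mpush_subdef : {measure set T' -> \bar R}.
Proof. by unshelve refine (pushforward m f : {measure set T' -> \bar R}). Defined.

Definition mpush := mpush_subdef.

Lemma mpushE E : mpush E = m (f @^-1` E).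
Proof. by []. Qed.

End pushforward_measure.

Section sigma_finite_copy.
Context (d : measure_display) (T : measurableType d) (R : realType)
  (m : {measure set T -> \bar R}).

(** An alias depending on the proof, so that the sigma-finite structure demanded by Tonelli's
    theorem can be attached to a measure that is only a variable. *)
Definition sigma_finite_copy of sigma_finite setT m : set T -> \bar R := m.

Hypothesis mS : sigma_finite setT m.

HB.instance Definition _ := Measure.copy (sigma_finite_copy mS) m.
HB.instance Definition _ :=
  Measure_isSigmaFinite.Build _ T R (sigma_finite_copy mS) mS.

End sigma_finite_copy.

Definition tadd (R : realType) (k : nat) (x y : k.-tuple R) : k.-tuple R :=
  [tuple tnth x i + tnth y i | i < k].

Definition topp (R : realType) (k : nat) (x : k.-tuple R) : k.-tuple R :=
  [tuple - tnth x i | i < k].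

Definition box (R : realType) (k : nat) (a b : k.-tuple R) : set (k.-tuple R) :=
  [set x | forall i, tnth a i <= tnth x i <= tnth b i].

Lemma measurable_tuple_fun (d : measure_display) (T : measurableType d)
    (R : realType) (k : nat) (f : 'I_k -> T -> R) :
  (forall i, measurable_fun setT (f i)) ->
  measurable_fun setT (fun x => [tuple f i x | i < k]).
Proof.
move=> mf; apply/measurable_fun_tnthP => i.
by rewrite (_ : _ \o _ = f i) //; apply/funext => x /=; rewrite tnth_mktuple.
Qed.

Lemma measurable_mxact (R : realType) (k : nat) (A : 'M[R]_k) :
  measurable_fun setT (mxact A).
Proof.
apply: measurable_tuple_fun => i; apply: measurable_sum => j.
by apply: measurable_funM => //; exact: measurable_tnth.
Qed.

Lemma mxactK (R : realType) (k : nat) (M N : 'M[R]_k) (x : k.-tuple R) :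
  M *m N = 1%:M -> mxact M (mxact N x) = x.
Proof.
move=> MN; apply: eq_from_tnth => i; rewrite !tnth_mktuple.
transitivity (\sum_l (M *m N) i l * tnth x l).
  under [RHS]eq_bigr do rewrite mxE big_distrl /=.
  rewrite exchange_big; apply: eq_bigr => j _.
  rewrite tnth_mktuple big_distrr; apply: eq_bigr => l _ /=; by rewrite mulrA.
rewrite MN (bigD1 i) //= mxE eqxx mul1r big1 ?addr0 // => l li.
by rewrite mxE eq_sym (negbTE li) mul0r.
Qed.

Lemma measurable_topp (R : realType) (k : nat) : measurable_fun setT (@topp R k).
Proof.
by apply: measurable_tuple_fun => i; apply: measurable_funN; exact: measurable_tnth.
Qed.

Lemma measurable_tadd (d : measure_display) (T : measurableType d) (R : realType)
    (k : nat) (f g : T -> k.-tuple R) : measurable_fun setT f -> measurable_fun setT g ->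
  measurable_fun setT (fun x => tadd (f x) (g x)).
Proof.
move=> mf mg; apply: measurable_tuple_fun => i.
apply: measurable_funD.
  exact: (measurableT_comp (measurable_tnth i) mf).
exact: (measurableT_comp (measurable_tnth i) mg).
Qed.

Lemma measurable_preimageT (d d' : measure_display) (T : measurableType d)
    (T' : measurableType d') (f : T -> T') (E : set T') :
  measurable_fun setT f -> measurable E -> measurable (f @^-1` E).
Proof. by move=> mf mE; rewrite -[X in measurable X]setTI; exact: mf. Qed.

(** Cavalieri's principle: both sides are iterated integrals of the indicator of [D]. *)
Lemma fubini_sections (d d' : measure_display) (T : measurableType d)
    (T' : measurableType d') (R : realType)
    (m : {sigma_finite_measure set T -> \bar R})
    (m' : {sigma_finite_measure set T' -> \bar R}) (D : set (T * T')) :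
  measurable D ->
  (\int[m]_x m' [set y | D (x, y)] = \int[m']_y m [set x | D (x, y)])%E.
Proof.
move=> mD.
have mf : measurable_fun setT (fun z : T * T' => (\1_D z : R)%:E).
  by apply/measurable_EFinP; exact: measurable_indic.
have H := fubini_tonelli (m1 := m) (m2 := m') _ mf (fun z => ltac:(by rewrite lee_fin)).
transitivity (\int[m]_x \int[m']_y (\1_D (x, y))%:E)%E.
  apply: eq_integral => x _.
  rewrite (_ : (fun y => (\1_D (x, y))%:E) = (fun y => (\1_[set y | D (x, y)] y)%:E)).
    rewrite integral_indic ?setIT //.
    exact: (measurable_preimageT (pair1_measurable x) mD).
  by apply/funext => y; rewrite !indicE; congr (nat_of_bool _)%:R%:E; apply/idP/idP; rewrite !inE.
rewrite {}H.
apply: eq_integral => y _.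
rewrite (_ : (fun x => (\1_D (x, y))%:E) = (fun x => (\1_[set x | D (x, y)] x)%:E)).
  rewrite integral_indic ?setIT //.
  exact: (measurable_preimageT (pair2_measurable y) mD).
by apply/funext => x; rewrite !indicE; congr (nat_of_bool _)%:R%:E; apply/idP/idP; rewrite !inE.
Qed.

Definition translation_invariant (R : realType) (k : nat)
  (m : set (k.-tuple R) -> \bar R) : Prop :=
  forall E y, measurable E -> m [set x | E (tadd x y)] = m E.

(* Integrate [1_E(x) 1_B(x + y)] against [m(dx) m'(dy)] in both orders. With
   [m' = m] it shows that [m] is symmetric, and then that any [m'] is
   proportional to [m], without identifying the constant. *)
Lemma haar_swap (R : realType) (k : nat)
    (m m' : {sigma_finite_measure set (k.-tuple R) -> \bar R}) (E B : set (k.-tuple R)) :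
  translation_invariant m -> translation_invariant m' ->
  measurable E -> measurable B -> (m E * m' B = m B * m' (@topp R k @^-1` E))%E.
Proof.
move=> tm tm' mE mB.
have taddC (x y : k.-tuple R) : tadd x y = tadd y x.
  by apply: eq_from_tnth => i; rewrite !tnth_mktuple addrC.
have taddK (x y : k.-tuple R) : tadd (tadd x y) (topp y) = x.
  by apply: eq_from_tnth => i; rewrite !tnth_mktuple addrK.
have toppB (x y : k.-tuple R) : tadd y (topp x) = topp (tadd x (topp y)).
  by apply: eq_from_tnth => i; rewrite !tnth_mktuple opprB.
(* When all sections have the same measure, the iterated integral is a product. *)
have splitI (m1 m2 : {measure set (k.-tuple R) -> \bar R}) (P : set (k.-tuple R))
    (Q : k.-tuple R -> set (k.-tuple R)) c : measurable P ->
    (forall x, m1 (Q x) = c) ->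
    (\int[m2]_x m1 [set y | P x /\ Q x y] = m2 P * c)%E.
  move=> mP Qc.
  transitivity (\int[m2]_x ((\1_P x)%:E * c))%E.
    apply: eq_integral => x _; rewrite indicE; have [xP|xP] := pselect (P x).
      rewrite mem_set // mul1e -(Qc x); congr (m1 _).
      by apply/seteqP; split => y /=; tauto.
    rewrite memNset // mul0e (_ : mkset _ = set0) ?measure0 //.
    by apply/seteqP; split => y //= -[].
  rewrite ge0_integralZr //.
  - by rewrite integral_indic // setIT.
  - by apply/measurable_EFinP; exact: measurable_indic.
  - by rewrite -(Qc (nseq_tuple k 0)).
have mC (P Q : set (k.-tuple R)) f : measurable P -> measurable Q ->
    measurable_fun setT f ->
    measurable [set z : k.-tuple R * k.-tuple R | P z.1 /\ Q (f z)].
  move=> mP mQ mf; rewrite (_ : mkset _ = fst @^-1` P `&` f @^-1` Q) //.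
  by apply: measurableI; apply: measurable_preimageT.
have mD2 : measurable_fun setT
    (fun z : k.-tuple R * k.-tuple R => tadd z.1 (topp z.2)).
  by apply: measurable_tadd => //; exact: measurableT_comp (@measurable_topp R k) _.
transitivity (\int[m]_x m' [set y | E x /\ B (tadd x y)])%E.
  rewrite (splitI _ _ _ _ (m' B)) // => x.
  rewrite -[RHS](tm' _ x mB); congr (m' _); apply/funext => y.
  by rewrite /= taddC.
rewrite (@fubini_sections _ _ _ _ _ m m' [set z | E z.1 /\ B (tadd z.1 z.2)]); last first.
  by apply: mC => //; exact: measurable_tadd.
(* For fixed [y] a translation by [y], which preserves [m], replaces the pair (x, x + y) by (x - y,
   x). *)
transitivity (\int[m']_y m [set x | B x /\ E (tadd x (topp y))])%E.
  apply: eq_integral => y _.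
  rewrite -(tm [set x | B x /\ E (tadd x (topp y))] y).
    by congr (m _); apply/funext => x /=; rewrite taddK; apply/propext; tauto.
  apply: measurableI => //; apply: (@measurable_preimageT _ _ _ _ (fun x => tadd x (topp y))) => //.
  by apply: measurable_tadd.
rewrite -(@fubini_sections _ _ _ _ _ m m' [set z | B z.1 /\ E (tadd z.1 (topp z.2))]); last first.
  exact: mC.
apply: (splitI m' m B (fun x => [set y | E (tadd x (topp y))])) => // x.
(* For fixed [x] the set of all y with x - y in E is a translate of -E. *)
rewrite -(tm' (@topp R k @^-1` E) (topp x)); last first.
  by apply: measurable_preimageT => //; exact: measurable_topp.
by congr (m' _); apply/funext => y; rewrite /= -toppB taddC.
Qed.

Section boxes.
Context {R : realType} {k : nat}.
Implicit Types (a b : k.-tuple R).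

Lemma box_setI a b a' b' : box a b `&` box a' b' =
  box [tuple Num.max (tnth a i) (tnth a' i) | i < k]
      [tuple Num.min (tnth b i) (tnth b' i) | i < k].
Proof.
apply/seteqP; split => x.
  move=> [xab xab'] i; rewrite !tnth_mktuple ge_max le_min.
  have /andP[-> ->] := xab i; have /andP[h1 h2] := xab' i.
  by apply/andP; split.
move=> xI; split=> i; move: (xI i);
  by rewrite !tnth_mktuple ge_max le_min => /andP[/andP[h1 h2] /andP[h3 h4]]; apply/andP.
Qed.

Lemma measurable_box a b : measurable (box a b).
Proof.
rewrite (_ : box a b = \big[setI/setT]_(i < k)
    ((fun x : k.-tuple R => tnth x i) @^-1` `[tnth a i, tnth b i])).
  by apply: bigsetI_measurable => i _; apply: measurable_preimageT => //; exact: measurable_tnth.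
rewrite -bigcap_seq; apply/seteqP; split => x.
  by move=> xab i _ /=; rewrite in_itv /= xab.
by move=> xab i; have := xab i; rewrite /= mem_index_enum in_itv /=; apply.
Qed.

Definition cube (r : R) : set (k.-tuple R) := box (nseq_tuple k (- r)) (nseq_tuple k r).

Lemma cubeP r (x : k.-tuple R) : cube r x <-> forall i, `|tnth x i| <= r.
Proof.
by split=> xr i; have := xr i; rewrite !tnth_nseq ler_norml.
Qed.

Lemma bigcup_cube : \bigcup_n cube n%:R = setT.
Proof.
apply/seteqP; split => // x _.
exists (\max_(i < k) Num.trunc `|tnth x i|).+1 => //; apply/cubeP => i.
have /andP[_ /ltW/le_trans] := Num.Theory.trunc_itv (normr_ge0 (tnth x i)); apply.
by rewrite ler_nat ltnS; apply: (@leq_bigmax _ (fun i => Num.trunc `|tnth x i|)).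
Qed.

(** Together with [box_setI] this makes the boxes a generating pi-system, as the uniqueness theorem
    for measures requires. *)
Lemma measurable_tuple_boxes :
  @measurable _ (k.-tuple R) = <<s [set box ab.1 ab.2 | ab in [set: k.-tuple R * k.-tuple R]] >>.
Proof.
apply/seteqP; split; last first.
  apply: smallest_sub; first exact: sigma_algebra_measurable.
  by move=> _ [ab _ <-]; exact: measurable_box.
apply: smallest_sub; first exact: smallest_sigma_algebra.
rewrite -bigcup_seq => E [/= i _ [Y mY <-]].
have := @measurability _ _
  (g_sigma_algebraType [set box ab.1 ab.2 | ab in [set: k.-tuple R * k.-tuple R]])
  R setT (fun x : k.-tuple R => tnth x i) _ (RGenCInfty.measurableE R).
apply => //.
move=> _ [_ [r ->] <-]; rewrite setTI.
(* The half-space x_i >= r is exhausted by boxes with lower face r in coordinate i and all other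
   faces at distance n. *)
rewrite (_ : _ @^-1` _ = \bigcup_n
  box [tuple (if j == i then r else - n%:R) | j < k] (nseq_tuple k n%:R)).
  apply: bigcup_measurable => n _; apply: sub_sigma_algebra.
  exact: (ex_intro2 _ _ (_, _) I erefl).
apply/seteqP; split => x /=; rewrite ?in_itv /= ?andbT.
  move=> rx; have : (\bigcup_n cube n%:R) x by rewrite bigcup_cube.
  move=> [n _ /cubeP xn]; exists n => // j; rewrite tnth_mktuple tnth_nseq.
  move: (xn j); rewrite ler_norml => /andP[h1 h2]; apply/andP; split => //.
  by case: eqP => // ->.
by move=> [n _ /(_ i)]; rewrite tnth_mktuple eqxx => /andP[].
Qed.

End boxes.

Section lebesgue.
Context {R : realType} {k : nat} (w : {measure set (k.-tuple R) -> \bar R}).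
Hypothesis wL : is_lebesgue_k w.

Lemma lebesgue_cube_lty (r : R) : (w (cube r) < +oo)%E.
Proof.
have [r0|r0] := leP 0 r.
  rewrite wL ?ltry // => i; rewrite !tnth_nseq; lra.
(* In dimension 0 the cube is the one-point space even for negative [r], so it has measure 1 and not
   0. *)
case: (posnP k) => [k0|k0].
  by rewrite wL ?ltry // => i; exfalso; have := ltn_ord i; lia.
rewrite (_ : cube r = set0) ?measure0 ?ltry //.
apply/seteqP; split => // x /cubeP/(_ (Ordinal k0)) => xr.
by have := le_trans (normr_ge0 _) xr; rewrite leNgt r0.
Qed.

Lemma lebesgue_sigma_finite : sigma_finite setT w.
Proof.
exists (fun n => cube n%:R); first by rewrite bigcup_cube.
by move=> n; split; [exact: measurable_box|exact: lebesgue_cube_lty].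
Qed.

(** [w] and its translate agree on the boxes, a generating pi-system exhausted by cubes of finite
    measure. *)
Lemma lebesgue_translation : translation_invariant w.
Proof.
move=> E y mE.
have mty : measurable_fun setT (fun x : k.-tuple R => tadd x y).
  by apply: measurable_tadd.
pose m1 := mpush w mty.
have H := @measure_unique _ R _ _ (fun n => cube n%:R) measurable_tuple_boxes _ _ bigcup_cube w m1.
apply/esym/H => //.
- move=> _ _ [ab _ <-] [ab' _ <-]; rewrite box_setI.
  exact: (ex_intro2 _ _ (_, _) I erefl).
- by move=> n; exact: (ex_intro2 _ _ (_, _) I erefl).
- move=> _ [[a b] _ <-] /=; rewrite (mpushE w mty).
  transitivity (w (box (tadd a (topp y)) (tadd b (topp y)))); last first.
    congr (w _); apply/seteqP; split => x xab i; have := xab i;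
      by rewrite /= !tnth_mktuple lerBlDr lerBrDr.
  have [ab|] := pselect (forall i, tnth a i <= tnth b i).
    rewrite !wL //; last by move=> i; rewrite !tnth_mktuple lerD2r.
    congr _%:E; apply: eq_bigr => i _; rewrite !tnth_mktuple; lra.
  (* [is_lebesgue_k] does not speak of boxes with an inverted side; these are empty, and so are
     their translates. *)
  move/existsNP => [i /negP]; rewrite -ltNge => abi.
  have -> : box a b = set0.
    by apply/seteqP; split => // x /(_ i) /andP[h1 h2]; have := le_trans h1 h2; rewrite leNgt abi.
  have -> : box (tadd a (topp y)) (tadd b (topp y)) = set0.
    apply/seteqP; split => // x /(_ i) /andP[h1 h2]; have := le_trans h1 h2.
    by rewrite !tnth_mktuple lerD2r leNgt abi.
  by rewrite !measure0.
- by move=> n; exact: lebesgue_cube_lty. 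
Qed.

(** The image of [w] under A is again sigma-finite and translation invariant, so [haar_swap] makes
    it a multiple of [w] without any determinant. The constant is the measure of the preimage of the
    cube [-1, 1]^k divided by its volume 2^k. *)
Lemma lebesgue_mxact (A : 'M[R]_k) : A \in unitmx ->
  exists2 d : R, 0 < d &
  forall E, measurable E -> w (mxact A @^-1` E) = (d%:E * w E)%E.
Proof.
move=> Au.
have mA := measurable_mxact A.
have AK x := mxactK x (mulmxV Au); have AVK x := mxactK x (mulVmx Au).
have mxactD x y : mxact A (tadd x y) = tadd (mxact A x) (mxact A y).
  apply: eq_from_tnth => i; rewrite !tnth_mktuple -big_split; apply: eq_bigr => j _.
  by rewrite !tnth_mktuple mulrDr.
pose nu := mpush w mA.
have nuT : translation_invariant nu.
  move=> E y mE; rewrite !(mpushE w mA).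
  rewrite -[RHS](@lebesgue_translation _ (mxact (invmx A) y)); last first.
    exact: measurable_preimageT.
  by congr (w _); apply/funext => x /=; rewrite mxactD AK.
have nuS : sigma_finite setT nu.
  exists (fun n => mxact (invmx A) @^-1` cube n%:R).
    by rewrite -preimage_bigcup bigcup_cube preimage_setT.
  move=> n; split.
    by apply: measurable_preimageT; [exact: measurable_mxact|exact: measurable_box].
  rewrite (mpushE w mA) -comp_preimage (_ : _ \o _ = id); last exact/funext.
  exact: lebesgue_cube_lty.
pose ws : {sigma_finite_measure set (k.-tuple R) -> \bar R} :=
  sigma_finite_copy lebesgue_sigma_finite.
pose ns : {sigma_finite_measure set (k.-tuple R) -> \bar R} := sigma_finite_copy nuS.
have mB : measurable (cube 1 : set (k.-tuple R)) by exact: measurable_box.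
have ww E : measurable E -> (w E * w (cube 1) = w (cube 1) * w (@topp R k @^-1` E))%E.
  by move=> mE; exact: (haar_swap (m := ws) (m' := ws) lebesgue_translation lebesgue_translation mE mB).
have wn E : measurable E -> (w E * nu (cube 1) = w (cube 1) * nu (@topp R k @^-1` E))%E.
  by move=> mE; exact: (haar_swap (m := ws) (m' := ns) lebesgue_translation nuT mE mB).
have wB : w (cube 1) = ((2 ^+ k : R)%:E).
  rewrite wL; last by move=> i; rewrite !tnth_nseq; lra.
  under eq_bigr do rewrite !tnth_nseq opprK.
  by rewrite prodr_const card_ord.
have two0 : (2 ^+ k : R) != 0 by rewrite expf_neq0.
have toppK : @topp R k \o @topp R k = id.
  by apply/funext => x; apply: eq_from_tnth => i; rewrite !tnth_mktuple opprK.
(* [ww] at E gives w(-E) = w(E), and [wn] at -E then expresses nu(E) through w(E). *)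
have nuE E : measurable E -> nu E = (((2 ^+ k)^-1 : R)%:E * nu (cube 1) * w E)%E.
  move=> mE; have mE' : measurable (@topp R k @^-1` E).
    by apply: measurable_preimageT => //; exact: measurable_topp.
  have := wn _ mE'; have := ww _ mE; rewrite -comp_preimage toppK preimage_id wB.
  move=> h1 h2; have -> : w E = w (@topp R k @^-1` E).
    rewrite -[LHS]mul1e -(mulVf two0) EFinM -muleA (muleC _ (w E)) h1.
    by rewrite muleA -EFinM mulVf // mul1e.
  by rewrite -muleA (muleC (nu (cube 1))) h2 muleA -EFinM mulVf // mul1e.
have nuB : (nu (cube 1) < +oo)%E.
  (* A^-1 maps the cube of radius 1 into the cube of radius M. *)
  pose M := \sum_i \sum_j `|invmx A i j|.
  apply: (@le_lt_trans _ _ (w (cube M))); last exact: lebesgue_cube_lty.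
  rewrite (mpushE w mA); apply: le_measure; rewrite ?inE;
    [exact: measurable_preimageT|exact: measurable_box|].
  move=> x /= /cubeP xB; apply/cubeP => i; rewrite -(AVK x) tnth_mktuple.
  apply: le_trans (ler_norm_sum _ _ _) _.
  apply: (@le_trans _ _ (\sum_j `|invmx A i j|)); last first.
    by rewrite /M [leRHS](bigD1 i) //= lerDl; apply: sumr_ge0 => j _; apply: sumr_ge0.
  apply: ler_sum => j _; rewrite normrM ler_piMr //.
have nuB0 : (0 <= nu (cube 1))%E by exact: measure_ge0.
have nuBf : nu (cube 1) \is a fin_num by rewrite ge0_fin_numE.
exists ((2 ^+ k)^-1 * fine (nu (cube 1))).
  apply: mulr_gt0; first by rewrite invr_gt0 exprn_gt0.
  rewrite fine_gt0 // nuB andbT lt_neqAle nuB0 andbT; apply/eqP => nu0.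
  (* Otherwise [nu] would vanish identically, and with it w of the whole space, against w(cube 1) =
     2^k. *)
  have := nuE setT measurableT; rewrite -nu0 mule0 mul0e (mpushE w mA) preimage_setT => w0.
  have : (w (cube 1) <= w setT)%E by apply: le_measure; rewrite ?inE.
  by rewrite w0 wB lee_fin leNgt exprn_gt0.
by move=> E mE; rewrite -[LHS]/(nu E) nuE // EFinM fineK.
Qed.
End lebesgue.

(** * The Hilbert space L^2 *)

(* The carrier consists of the elements of [P] that are the chosen
   representative of their class modulo [Z]. *)
Section lmod_quotient.
Context (C : nzRingType) (E : lmodType C) (P Z : E -> Prop).
Hypothesis P0 : P 0.
Hypothesis Plin : forall c x y, P x -> P y -> P (c *: x + y).
Hypothesis Z0 : Z 0.
Hypothesis Zlin : forall c x y, Z x -> Z y -> Z (c *: x + y).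

Let canon (x : E) : E := xget 0 [set y | P y /\ Z (y - x)].
Local Notation K := {x : E | `[< P x /\ canon x = x >]}.

Let ZD x y : Z x -> Z y -> Z (x + y).
Proof. by move=> Zx Zy; rewrite -[x]scale1r; exact: Zlin. Qed.

Let ZN x : Z x -> Z (- x).
Proof. by move=> Zx; rewrite -[- x]addr0 -scaleN1r; exact: Zlin. Qed.

Let canonP x : P x -> P (canon x) /\ Z (canon x - x).
Proof.
move=> Px; rewrite /canon; case: xgetP => [y _ //|/(_ x)].
by case; split=> //; rewrite subrr.
Qed.

(** Equivalent elements have the same set of candidates, so [xget] returns the same choice for
    both. *)
Let canon_eq x y : Z (x - y) -> canon x = canon y.
Proof.
move=> Zxy; rewrite /canon; congr xget; apply/seteqP; split => z [Pz Zz]; split=> //.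
  by rewrite -(subrKA x); exact: ZD.
by rewrite -(subrKA y) -[in y - x](opprB x); apply: ZD => //; exact: ZN.
Qed.

Let canon_id x : P x -> P (canon x) /\ canon (canon x) = canon x.
Proof. by move=> /canonP[Pc Zc]; split=> //; exact: canon_eq. Qed.

Let k0 : K :=
  exist (fun x => is_true `[< P x /\ canon x = x >]) (canon 0) (asboolT (canon_id P0)).
(** On [P] the default [k0] is never returned, by [canon_id]. *)
Let proj (x : E) : K := insubd k0 (canon x).

Let val_proj x : P x -> val (proj x) = canon x.
Proof. by move=> Px; rewrite val_insubd ifT //; apply/asboolP; exact: canon_id. Qed.

Let P_val (u : K) : P (val u).
Proof. by case: u => x /= /asboolP[]. Qed.

Let proj_val (u : K) : proj (val u) = u.
Proof.
by apply: val_inj; rewrite val_proj //; case: u => x /= /asboolP[].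
Qed.

Let proj_eq x y : P x -> P y -> Z (x - y) -> proj x = proj y.
Proof. by move=> Px Py Zxy; apply: val_inj; rewrite !val_proj //; exact: canon_eq. Qed.

Let PD x y : P x -> P y -> P (x + y).
Proof. by move=> Px Py; rewrite -[x]scale1r; exact: Plin. Qed.

Let PZ c x : P x -> P (c *: x).
Proof. by move=> Px; rewrite -[_ *: _]addr0; exact: Plin. Qed.

Let Zval x : P x -> Z (val (proj x) - x).
Proof. by move=> Px; rewrite val_proj //; case: (canonP Px). Qed.

Let add (u v : K) : K := proj (val u + val v).
Let opp (u : K) : K := proj (- val u).
Let scale (c : C) (u : K) : K := proj (c *: val u).

Let PN x : P x -> P (- x).
Proof. by rewrite -scaleN1r; exact: PZ. Qed.

Let projD x y : P x -> P y -> proj (x + y) = add (proj x) (proj y).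
Proof.
move=> Px Py; apply/esym/proj_eq; [exact: PD|exact: PD|].
by rewrite opprD addrACA; apply: ZD; exact: Zval.
Qed.

Let projZ c x : P x -> proj (c *: x) = scale c (proj x).
Proof.
move=> Px; apply/esym/proj_eq; [exact: PZ|exact: PZ|].
by rewrite -scalerBr -[_ *: _]addr0; apply: Zlin => //; exact: Zval.
Qed.

Let addA : associative add.
Proof.
move=> u v w; rewrite -[u]proj_val -[v]proj_val -[w]proj_val.
by rewrite -!projD ?addrA //; exact: PD.
Qed.

Let addC : commutative add.
Proof. by move=> u v; rewrite /add addrC. Qed.

Let add0 : left_id (proj 0) add.
Proof. by move=> u; rewrite -[u]proj_val -projD // add0r. Qed.

Let addN : left_inverse (proj 0) opp add.
Proof.
move=> u; rewrite -{2}[u]proj_val /opp -projD ?addNr //; exact: PN.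
Qed.

Let zmodMixin := GRing.isZmodule.Build K addA addC add0 addN.
Let zmodK : zmodType := HB.pack K zmodMixin.

Let scaleA c c' (u : zmodK) : scale c (scale c' u) = scale (c * c') u.
Proof. by rewrite -[u]proj_val -!projZ ?scalerA //; exact: PZ. Qed.

Let scale1 : left_id 1 (scale : C -> zmodK -> zmodK).
Proof. by move=> u; rewrite -[RHS]proj_val /scale scale1r. Qed.

Let scaleDr : right_distributive (scale : C -> zmodK -> zmodK) +%R.
Proof.
move=> c u v; have Pu := P_val u; have Pv := P_val v.
rewrite -[u]proj_val -[v]proj_val -[X in scale c X]projD // -!projZ //; last exact: PD.
by rewrite scalerDr projD //; exact: PZ.
Qed.

Let scaleDl (u : zmodK) : {morph (scale : C -> zmodK -> zmodK) ^~ u : a b / a + b}.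
Proof.
have Pu := P_val u; move=> c c'; rewrite /= -[u]proj_val -!projZ // scalerDl [LHS]projD //; exact: PZ.
Qed.

Let lmodMixin := GRing.Zmodule_isLmodule.Build C zmodK scaleA scale1 scaleDr scaleDl.
Let lmodK : lmodType C := HB.pack zmodK lmodMixin.

(** [pi] is total, so that it takes functions without a membership proof, but linear only on [P];
    [rho] returns the chosen representatives. *)
Lemma lmod_quotient : exists (Q : lmodType C) (pi : E -> Q) (rho : Q -> E),
  [/\ forall u, P (rho u), forall u, pi (rho u) = u,
      forall c x y, P x -> P y -> pi (c *: x + y) = c *: pi x + pi y &
      forall x y, P x -> P y -> pi x = pi y <-> Z (x - y)].
Proof.
exists lmodK, proj, (val : K -> E); split => //.
- by move=> c x y Px Py; rewrite projD ?projZ //; exact: PZ.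
- move=> x y Px Py; split; last exact: proj_eq.
  move=> /(congr1 (val : K -> E)) pxy; have := ZD (ZN (Zval Px)) (Zval Py).
  by rewrite opprB pxy subrKA.
Qed.

End lmod_quotient.

Section cabs2_theory.
Context {R : realType}.
Implicit Types x y : complex R.

Lemma cabs2_ge0 x : 0 <= cabs2 x.
Proof. by rewrite addr_ge0 // sqr_ge0. Qed.

Lemma cabs2M x y : cabs2 (x * y) = cabs2 x * cabs2 y.
Proof. by rewrite /cabs2 ReM ImM; ring. Qed.

Lemma cabs2_eq0 x : cabs2 x = 0 -> x = 0.
Proof.
move/eqP; rewrite paddr_eq0 ?sqr_ge0 // !sqrf_eq0 => /andP[/eqP rx /eqP ix].
by apply/eqP; rewrite eq_complex rx ix !eqxx.
Qed.

Lemma cabs2_real (r : R) : cabs2 r%:C%C = r ^+ 2.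
Proof. by rewrite /cabs2 /= expr0n addr0. Qed.

Lemma cabs2D_le x y : cabs2 (x + y) <= 2 * cabs2 x + 2 * cabs2 y.
Proof.
case: x y => [a b] [p q]; rewrite /cabs2 /= -subr_ge0.
rewrite [leRHS](_ : _ = (a - p) ^+ 2 + (b - q) ^+ 2); last by ring.
by rewrite addr_ge0 // sqr_ge0.
Qed.

(** Together with [Im_mulcJ_le] this dominates the integrand of the inner product of two
    square-integrable functions by an integrable function. *)
Lemma Re_mulcJ_le x y : `|complex.Re (x * y^*)| <= cabs2 x + cabs2 y.
Proof.
case: x y => [a b] [p q]; rewrite /cabs2 ReM Re_conj Im_conj /= ler_norml.
have := sqr_ge0 (a - p); have := sqr_ge0 (a + p); have := sqr_ge0 (b - q); have := sqr_ge0 (b + q).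
have := sqr_ge0 a; have := sqr_ge0 b; have := sqr_ge0 p; have := sqr_ge0 q.
rewrite !expr2 => *; lra.
Qed.

Lemma Im_mulcJ_le x y : `|complex.Im (x * y^*)| <= cabs2 x + cabs2 y.
Proof.
case: x y => [a b] [p q]; rewrite /cabs2 ImM Re_conj Im_conj /= ler_norml.
have := sqr_ge0 (a - q); have := sqr_ge0 (a + q); have := sqr_ge0 (b - p); have := sqr_ge0 (b + p).
have := sqr_ge0 a; have := sqr_ge0 b; have := sqr_ge0 p; have := sqr_ge0 q.
rewrite !expr2 => *; lra.
Qed.

End cabs2_theory.

Section L2c.
Context (d : measure_display) (T : measurableType d) (R : realType).
Context (nu : {measure set T -> \bar R}).
Local Notation C := (complex R).
Implicit Types F G H : T -> C.

Definition cmeasurable F : Prop :=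
  measurable_fun setT (fun x => complex.Re (F x)) /\
  measurable_fun setT (fun x => complex.Im (F x)).

(** [L2] over an arbitrary measurable space, since the extension lives over [nat * k.-tuple R]. On
    tuples the two are convertible. *)
Definition L2c F : Prop :=
  measurable_fun setT (fun x => complex.Re (F x)) /\
  measurable_fun setT (fun x => complex.Im (F x)) /\
  (\int[nu]_x (cabs2 (F x))%:E < +oo)%E.

Lemma L2c_cmeasurable F : L2c F -> cmeasurable F.
Proof. by case=> ? []. Qed.

Lemma cmeasurableD F G : cmeasurable F -> cmeasurable G -> cmeasurable (fun x => F x + G x).
Proof.
move=> [rF iF] [rG iG]; split.
  by under eq_fun do rewrite ReD; exact: measurable_funD.
by under eq_fun do rewrite ImD; exact: measurable_funD.
Qed.

Lemma cmeasurableM F G : cmeasurable F -> cmeasurable G -> cmeasurable (fun x => F x * G x).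
Proof.
move=> [rF iF] [rG iG]; split.
  by under eq_fun do rewrite ReM; apply: measurable_funB; exact: measurable_funM.
by under eq_fun do rewrite ImM; apply: measurable_funD; exact: measurable_funM.
Qed.

Lemma cmeasurable_conj F : cmeasurable F -> cmeasurable (fun x => (F x)^*).
Proof.
move=> [rF iF]; split; first by under eq_fun do rewrite Re_conj.
by under eq_fun do rewrite Im_conj; exact: measurable_funN.
Qed.

Lemma cmeasurable_cst (c : C) : cmeasurable (fun=> c).
Proof. by split; exact: measurable_cst. Qed.

Lemma cmeasurable_real (f : T -> R) : measurable_fun setT f -> cmeasurable (fun x => (f x)%:C%C).
Proof. by move=> mf; split => //; exact: measurable_cst. Qed.

Lemma measurable_cabs2 F : cmeasurable F -> measurable_fun setT (fun x => cabs2 (F x)).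
Proof. by move=> [rF iF]; apply: measurable_funD; exact: measurable_funX. Qed.

Lemma measurable_cabs2E F : cmeasurable F -> measurable_fun setT (fun x => (cabs2 (F x))%:E).
Proof. by move=> mF; apply/measurable_EFinP; exact: measurable_cabs2. Qed.

Lemma L2c_le F G (c : R) : 0 <= c -> cmeasurable F -> L2c G ->
  (forall x, cabs2 (F x) <= c * cabs2 (G x)) -> L2c F.
Proof.
move=> c0 mF LG FG; have [rF iF] := mF; split => //; split => //.
have [_ [_ intG]] := LG; have mG := measurable_cabs2E (L2c_cmeasurable LG).
apply: (@le_lt_trans _ _ (\int[nu]_x (c%:E * (cabs2 (G x))%:E))%E).
  apply: ge0_le_integral => //.
  - by move=> x _; rewrite lee_fin cabs2_ge0.
  - exact: measurable_cabs2E.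
  - under eq_fun do rewrite -EFinM; apply/measurable_EFinP.
    by apply: measurable_funM => //; apply/measurable_EFinP.
  - by move=> x _; rewrite -EFinM lee_fin.
rewrite ge0_integralZl //; last by move=> x _; rewrite lee_fin cabs2_ge0.
by apply: lte_mul_pinfty.
Qed.

Lemma L2cD F G : L2c F -> L2c G -> L2c (fun x => F x + G x).
Proof.
move=> LF LG; have mF := L2c_cmeasurable LF; have mG := L2c_cmeasurable LG.
have [rFG iFG] := cmeasurableD mF mG; split => //; split => //.
have [_ [_ intF]] := LF; have [_ [_ intG]] := LG.
have m2 H : cmeasurable H -> measurable_fun setT (fun x => (2 * cabs2 (H x))%:E).
  by move=> mH; apply/measurable_EFinP; apply: measurable_funM => //; exact: measurable_cabs2.
have i2 H : L2c H -> (\int[nu]_x (2 * cabs2 (H x))%:E < +oo)%E.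
  move=> LH; under eq_integral do rewrite EFinM.
  rewrite ge0_integralZl //; last 2 first.
  - exact: (measurable_cabs2E (L2c_cmeasurable _)).
  - by move=> x _; rewrite lee_fin cabs2_ge0.
  by apply: lte_mul_pinfty => //; case: LH => ? [].
apply: (@le_lt_trans _ _ (\int[nu]_x ((2 * cabs2 (F x))%:E + (2 * cabs2 (G x))%:E))%E).
  apply: ge0_le_integral => //.
  - by move=> x _; rewrite lee_fin cabs2_ge0.
  - exact: (measurable_cabs2E (cmeasurableD _ _)).
  - by apply: emeasurable_funD; exact: m2.
  - by move=> x _; rewrite -EFinD lee_fin cabs2D_le.
rewrite ge0_integralD //; first by rewrite lte_add_pinfty // i2.
- by move=> x _; rewrite lee_fin mulr_ge0 // cabs2_ge0.
- exact: m2.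
- by move=> x _; rewrite lee_fin mulr_ge0 // cabs2_ge0.
- exact: m2.
Qed.

Lemma L2cZ (c : C) F : L2c F -> L2c (fun x => c * F x).
Proof.
move=> LF; apply: (@L2c_le _ F (cabs2 c)) => //; first exact: cabs2_ge0.
  by apply: cmeasurableM; [exact: cmeasurable_cst|exact: L2c_cmeasurable].
by move=> x; rewrite cabs2M.
Qed.

Lemma L2c0 : L2c (fun=> 0).
Proof.
split; first exact: measurable_cst; split; first exact: measurable_cst.
under eq_integral do rewrite /cabs2 /= expr0n addr0.
by rewrite integral0.
Qed.

Lemma L2c_ae F G : cmeasurable G -> {ae nu, forall x, F x = G x} -> L2c F -> L2c G.
Proof.
move=> mG FG LF; have [rG iG] := mG; split => //; split => //; case: (LF) => _ [_].
rewrite (@ae_eq_integral _ _ _ nu _ (fun x => (cabs2 (G x))%:E)) //.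
- exact: (measurable_cabs2E (L2c_cmeasurable _)).
- exact: measurable_cabs2E.
- by apply: filterS FG => x -> _.
Qed.

Definition cintegrable F : Prop :=
  nu.-integrable setT (EFin \o (fun x => complex.Re (F x))) /\
  nu.-integrable setT (EFin \o (fun x => complex.Im (F x))).

Definition cint F : C :=
  Complex (\int[nu]_x complex.Re (F x)) (\int[nu]_x complex.Im (F x)).

Lemma cint_lin (c : C) F G : cintegrable F -> cintegrable G ->
  cint (fun x => c * F x + G x) = c * cint F + cint G.
Proof.
move=> [rF iF] [rG iG].
have iZ (s : R) (f : T -> R) : nu.-integrable setT (EFin \o f) ->
    nu.-integrable setT (EFin \o (fun x => s * f x)).
  by move=> intf; rewrite (_ : _ \o _ = (fun x => s%:E * (f x)%:E)%E) //; exact: integrableZl.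
apply/eqP; rewrite eq_complex; apply/andP; split; apply/eqP.
  rewrite /= ReD ReM /=; under eq_Rintegral do rewrite ReD ReM /=.
  rewrite RintegralD //; last first.
    rewrite (_ : _ \o _ = ((EFin \o (fun x => (complex.Re c * complex.Re (F x))%R)) \-
      (EFin \o (fun x => (complex.Im c * complex.Im (F x))%R)))%E) //.
    by apply: integrableB => //; exact: iZ.
  by rewrite RintegralB //; [rewrite !RintegralZl|exact: iZ..].
rewrite /= ImD ImM /=; under eq_Rintegral do rewrite ImD ImM /=.
rewrite RintegralD //; last first.
  rewrite (_ : _ \o _ = ((EFin \o (fun x => (complex.Re c * complex.Im (F x))%R)) \+
    (EFin \o (fun x => (complex.Im c * complex.Re (F x))%R)))%E) //.
  by apply: integrableD => //; exact: iZ.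
by rewrite RintegralD //; [rewrite !RintegralZl|exact: iZ..].
Qed.

Lemma cint_conj F : cintegrable F -> cint (fun x => (F x)^*) = (cint F)^*.
Proof.
move=> [rF iF]; apply/eqP; rewrite eq_complex Re_conj Im_conj; apply/andP; split; apply/eqP => /=.
  by under eq_Rintegral do rewrite Re_conj.
under eq_Rintegral do rewrite Im_conj -mulN1r.
by rewrite RintegralZl // mulN1r.
Qed.

Lemma cint_ae F G : cmeasurable F -> cmeasurable G ->
  {ae nu, forall x, F x = G x} -> cint F = cint G.
Proof.
move=> [rF iF] [rG iG] FG; congr Complex; congr fine; apply: ae_eq_integral => //;
  by [exact/measurable_EFinP | apply: filterS FG => x -> _].
Qed.

Definition l2ip F G : C := cint (fun x => F x * (G x)^*).

Lemma cintegrable_mulJ F G : L2c F -> L2c G -> cintegrable (fun x => F x * (G x)^*).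
Proof.
move=> LF LG; have mF := L2c_cmeasurable LF; have mG := L2c_cmeasurable LG.
have [rFG iFG] := cmeasurableM mF (cmeasurable_conj mG).
have dom : nu.-integrable setT (fun x => (cabs2 (F x) + cabs2 (G x))%:E).
  have i H : L2c H -> nu.-integrable setT (fun x => (cabs2 (H x))%:E).
    move=> LH; apply/integrableP; split.
      exact: (measurable_cabs2E (L2c_cmeasurable _)).
    under eq_integral do rewrite gee0_abs ?lee_fin ?cabs2_ge0 //.
    by case: LH => _ [].
  under eq_fun do rewrite EFinD.
  by apply: integrableD => //; exact: i.
split; apply: le_integrable dom => //.
- exact/measurable_EFinP.
- move=> x _; rewrite abse_EFin lee_fin.
  by rewrite (le_trans (Re_mulcJ_le _ _)) // ler_norm.
- exact/measurable_EFinP.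
- move=> x _; rewrite abse_EFin lee_fin.
  by rewrite (le_trans (Im_mulcJ_le _ _)) // ler_norm.
Qed.

Lemma l2ip_lin (c : C) F G H : L2c F -> L2c G -> L2c H ->
  l2ip (fun x => c * F x + G x) H = c * l2ip F H + l2ip G H.
Proof.
move=> LF LG LH; rewrite -cint_lin; [|exact: cintegrable_mulJ..].
by congr cint; apply/funext => x; rewrite mulrDl mulrA.
Qed.

Lemma l2ip_sym F G : L2c F -> L2c G -> l2ip G F = (l2ip F G)^*.
Proof.
move=> LF LG; rewrite -cint_conj; last exact: cintegrable_mulJ.
by congr cint; apply/funext => x; rewrite rmorphM /= conjCK mulrC.
Qed.

Lemma l2ip_self F : L2c F -> l2ip F F = (fine (\int[nu]_x (cabs2 (F x))%:E))%:C%C.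
Proof.
move=> LF; congr Complex.
  congr fine; apply: eq_integral => x _.
  by rewrite ReM Re_conj Im_conj /cabs2; congr EFin; ring.
under eq_Rintegral do rewrite ImM Re_conj Im_conj mulrN mulrC addNr.
by rewrite Rintegral_cst // mul0r.
Qed.

Lemma l2ip_ae F F' G G' : cmeasurable F -> cmeasurable F' -> cmeasurable G -> cmeasurable G' ->
  {ae nu, forall x, F x = F' x} -> {ae nu, forall x, G x = G' x} -> l2ip F G = l2ip F' G'.
Proof.
move=> mF mF' mG mG' FF' GG'; apply: cint_ae.
- by apply: cmeasurableM => //; exact: cmeasurable_conj.
- by apply: cmeasurableM => //; exact: cmeasurable_conj.
- by apply: filterS2 FF' GG' => x -> ->.
Qed.

Lemma L2c_null F : cmeasurable F -> (\int[nu]_x (cabs2 (F x))%:E = 0)%E ->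
  {ae nu, forall x, F x = 0}.
Proof.
move=> mF F0.
have := (@ae_eq_integral_abs _ _ _ nu setT measurableT _ (measurable_cabs2E mF)).1.
under eq_integral do rewrite gee0_abs ?lee_fin ?cabs2_ge0 //.
move=> /(_ F0); apply: filterS => x /(_ I) /=.
by case=> /cabs2_eq0.
Qed.

End L2c.

Lemma eq_L2c (d : measure_display) (T : measurableType d) (R : realType)
    (nu : {measure set T -> \bar R}) (F G : T -> complex R) :
  F =1 G -> L2c nu F -> L2c nu G.
Proof. by move=> /funext ->. Qed.

Lemma l2ipZ (d : measure_display) (T : measurableType d) (R : realType)
    (nu : {measure set T -> \bar R}) (c : complex R) (F G : T -> complex R) :
  L2c nu F -> L2c nu G -> l2ip nu (fun x => c * F x) G = c * l2ip nu F G.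
Proof.
move=> LF LG; have := l2ip_lin (c - 1) LF LF LG.
rewrite mulrBl mul1r subrK => <-; congr l2ip; apply/funext => x.
by rewrite mulrBl mul1r subrK.
Qed.

Section riesz_fischer.
Context (d : measure_display) (T : measurableType d) (R : realType).
Context (nu : {measure set T -> \bar R}).

Lemma limn_einf_le (u : (\bar R)^nat) (c : \bar R) :
  (forall n, (u n <= c)%E) -> (limn_einf u <= c)%E.
Proof.
move=> uc; rewrite limn_einf_lim; apply: lime_le; first exact: is_cvg_einfs.
apply: nearW => n; apply: le_trans (uc n); apply: ereal_inf_lbound => /=.
by exists n => /=.
Qed.

Lemma sum_half_le2 n : \sum_(0 <= i < n) ((2 ^+ i)^-1 : R) <= 2.
Proof.
suff -> : \sum_(0 <= i < n) ((2 ^+ i)^-1 : R) = 2 - 2 * (2 ^+ n)^-1.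
  by rewrite gerBl mulr_ge0 // invr_ge0 exprn_ge0.
elim: n => [|n IH]; first by rewrite big_geq // expr0 invr1 mulr1 subrr.
by rewrite big_nat_recr //= IH exprS invfM; field; rewrite expf_neq0.
Qed.

(* The weights 2^j make the a.e. convergence of [\sum_j |g_j|] elementary:
   |g| <= 2^j g^2 + 2^-j, so no Minkowski inequality is needed. *)
Lemma weighted_sq_cvg (g : nat -> R) :
  (\sum_(0 <= j <oo) (2 ^+ j * g j ^+ 2)%:E < +oo)%E -> cvgn (series g).
Proof.
move=> Sfin; apply: normed_cvg.
have S0 n : (0 <= n)%N -> true -> (0 <= (2 ^+ n * g n ^+ 2)%:E)%E.
  by rewrite lee_fin mulr_ge0 // ?sqr_ge0 // exprn_ge0.
apply: nondecreasing_is_cvgn.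
  move=> m n mn.
  exact: (nondecreasing_series (u_ := fun k => `|g k|) (P := xpredT) (fun k _ _ => normr_ge0 _) mn).
set S := (X in (X < _)%E) in Sfin.
have Sf : S \is a fin_num by rewrite ge0_fin_numE //; apply: nneseries_ge0 => n *; exact: S0.
exists (fine S + 2) => _ [n _ <-]; rewrite /series /=.
apply: (@le_trans _ _ (\sum_(0 <= j < n) (2 ^+ j * g j ^+ 2 + (2 ^+ j)^-1))).
  apply: ler_sum => j _.
  have t0 : (2 ^+ j : R) > 0 by rewrite exprn_gt0.
  have : 0 <= (2 ^+ j)^-1 * (2 ^+ j * `|g j| - 1) ^+ 2.
    by rewrite mulr_ge0 ?sqr_ge0 // invr_ge0 ltW.
  rewrite -[g j ^+ 2]real_normK ?num_real //.
  have -> : (2 ^+ j)^-1 * (2 ^+ j * `|g j| - 1) ^+ 2 =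
    2 ^+ j * `|g j| ^+ 2 - 2 * `|g j| + (2 ^+ j)^-1 by field; rewrite gt_eqF.
  have := normr_ge0 (g j); lra.
rewrite big_split /= lerD ?sum_half_le2 //.
rewrite -lee_fin fineK // -sumEFin; exact: nneseries_lim_ge.
Qed.

(** Riesz-Fischer: a sufficiently fast subsequence converges almost everywhere, and Fatou's lemma
    turns its pointwise limit into the L^2 limit of the whole sequence. *)
Lemma l2_complete (f : nat -> T -> R) : (forall n, measurable_fun setT (f n)) ->
  (forall e : R, 0 < e -> exists N, forall m n, (N <= m)%N -> (N <= n)%N ->
     (\int[nu]_x ((f m x - f n x) ^+ 2)%:E < e%:E)%E) ->
  exists2 g : T -> R, measurable_fun setT g &
  forall e : R, 0 < e -> exists N, forall n, (N <= n)%N ->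
     (\int[nu]_x ((f n x - g x) ^+ 2)%:E < e%:E)%E.
Proof.
move=> mf cauchy.
(* The factor 2^j cancels the weight in [weighted_sq_cvg]; the factor 2^(j+1) leaves a geometric
   series with sum 1. *)
have /choice [N NP] : forall j, exists N, forall m n, (N <= m)%N -> (N <= n)%N ->
    (\int[nu]_x ((f m x - f n x) ^+ 2)%:E < ((2 ^+ j * 2 ^+ j.+1)^-1)%:E)%E.
  by move=> j; apply: cauchy; rewrite invr_gt0 mulr_gt0 ?exprn_gt0.
(* A choice of indices that is increasing and exceeds both N j and j. *)
pose p j := (\sum_(i < j.+1) (N i).+1)%N.
have pS j : p j.+1 = (p j + (N j.+1).+1)%N by rewrite /p big_ord_recr.
have pN j : (N j <= p j)%N by rewrite /p big_ord_recr /=; lia.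
have pj j : (j <= p j)%N by elim: j => // j IH; rewrite pS; lia.
pose g j x := f (p j.+1) x - f (p j) x.
have mg j : measurable_fun setT (g j) by exact: measurable_funB.
pose S x := (\sum_(0 <= j <oo) (2 ^+ j * g j x ^+ 2)%:E)%E.
have S0 x n : (0 <= (2 ^+ n * g n x ^+ 2)%:E)%E.
  by rewrite lee_fin mulr_ge0 // ?sqr_ge0 // exprn_ge0.
have mSn j : measurable_fun setT (fun x => (2 ^+ j * g j x ^+ 2)%:E).
  by apply/measurable_EFinP; apply: measurable_funM => //; exact: measurable_funX.
have mS : measurable_fun setT S by apply: ge0_emeasurable_sum.
have Sge0 x : (0 <= S x)%E by apply: nneseries_ge0.
have intS : (\int[nu]_x S x < +oo)%E.
  rewrite integral_nneseries //.
  apply: (@le_lt_trans _ _ 1%E); last by rewrite ltry.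
  have := @cvg_geometric_eseries_half R 1 0.
  rewrite expr0 divr1 => /cvg_lim <- //.
  apply: lee_nneseries => [n _ _|n _]; first by apply: integral_ge0 => x _; exact: S0.
  under eq_integral do rewrite EFinM.
  rewrite ge0_integralZl //; last 2 first.
  - by apply/measurable_EFinP; exact: measurable_funX.
  - by move=> x _; rewrite lee_fin sqr_ge0.
  have pSn : (N n <= p n.+1)%N by rewrite pS; have := pN n; lia.
  have /ltW le_e := NP n (p n.+1) (p n) pSn (pN n).
  apply: (le_trans (lee_wpmul2l _ le_e)); first by rewrite lee_fin exprn_ge0.
  rewrite -EFinM lee_fin addn1 natrX div1r invfM mulrA mulfV ?expf_neq0 //.
  by rewrite mul1r.
have aeS : {ae nu, forall x, (S x < +oo)%E}.
  have iS : nu.-integrable setT S.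
    apply/integrableP; split=> //.
    by under eq_integral do rewrite gee0_abs //.
  by apply: filterS (integrable_ae measurableT iS) => x /(_ I) /fin_numPlt /andP[].
pose D := [set x | (S x < +oo)%E].
have mD : measurable D.
  by rewrite -[D]setTI; exact: emeasurable_fun_infty_o.
(* Set to 0 off [D], the subsequence converges at every point, which makes its limit measurable. *)
pose u j x := f (p j) x * \1_D x.
have cu x : cvgn (u ^~ x).
  have [Dx|Dx] := pselect (D x); last first.
    rewrite (_ : u ^~ x = cst 0); first exact: is_cvg_cst.
    by apply/funext => j; rewrite /u indicE memNset // mulr0.
  rewrite (_ : u ^~ x = cst (f (p 0) x) \+ series (g ^~ x)); last first.
    apply/funext => j; rewrite /u indicE mem_set // mulr1 /=.
    elim: j => [|j IH]; first by rewrite /series /= big_geq // addr0.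
    by rewrite seriesSr addrA -IH /g; ring.
  by apply: is_cvgD; [exact: is_cvg_cst|exact: weighted_sq_cvg].
pose h x := limn (u ^~ x).
have mu_ j : measurable_fun setT (u j).
  by apply: measurable_funM => //; exact: measurable_indic.
have mh : measurable_fun setT h.
  by apply: (measurable_fun_cvg (h := u)) => // x _; exact: cu.
exists h => // e e0.
(* Fatou's lemma preserves only non-strict bounds, so the Cauchy condition is used at e / 2. *)
have e20 : 0 < e / 2 by rewrite divr_gt0.
have [M MP] := cauchy _ e20.
exists M => n Mn.
have mfD : measurable_fun setT (fun x => f n x * \1_D x).
  by apply: measurable_funM => //; exact: measurable_indic.
have -> : (\int[nu]_x ((f n x - h x) ^+ 2)%:E =
    \int[nu]_x ((f n x * \1_D x - h x) ^+ 2)%:E)%E.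
  apply: ae_eq_integral => //.
  - by apply/measurable_EFinP; apply: measurable_funX; exact: measurable_funB.
  - by apply/measurable_EFinP; apply: measurable_funX; exact: measurable_funB.
  - by apply: filterS aeS => x Sx _; rewrite indicE mem_set // mulr1.
pose a j x := ((f n x * \1_D x - u (M + j)%N x) ^+ 2)%:E.
have ma j : measurable_fun setT (a j).
  by apply/measurable_EFinP; apply: measurable_funX; exact: measurable_funB.
have a0 j x : (0 <= a j x)%E by rewrite lee_fin sqr_ge0.
have ah x : limn_einf (a ^~ x) = ((f n x * \1_D x - h x) ^+ 2)%:E.
  have ca : a ^~ x @ \oo --> ((f n x * \1_D x - h x) ^+ 2)%:E.
    apply: cvg_EFin; first exact: nearW.
    rewrite (_ : _ \o _ = fun j => (f n x * \1_D x - u (M + j)%N x) ^+ 2) //.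
    rewrite expr2; under eq_cvg do rewrite expr2.
    suff H : (fun j => f n x * \1_D x - u (M + j)%N x) @ \oo --> f n x * \1_D x - h x.
      exact: (cvgM H H).
    apply: cvgB; first exact: cvg_cst.
    have := cu x; rewrite -(cvg_shiftn M (u ^~ x)) => ux.
    by under eq_cvg do rewrite addnC; exact: ux.
  rewrite is_cvg_limn_einfE; first exact/cvg_lim.
  by apply/cvg_ex; eexists; exact: ca.
under eq_integral do rewrite -ah.
apply: (le_lt_trans (fatou _ _ _ _)) => //.
apply: (@le_lt_trans _ _ (e / 2)%:E); last by rewrite lte_fin; lra.
apply: limn_einf_le => j.
apply: (le_trans _ (ltW (MP n (p (M + j)%N) Mn (leq_trans (leq_addr _ _) (pj _))))).
apply: ge0_le_integral => //.
- by apply/measurable_EFinP; apply: measurable_funX; exact: measurable_funB.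
- by move=> x _; rewrite /a /u -mulrBl exprMn lee_fin ler_piMr ?sqr_ge0 //.
Qed.

End riesz_fischer.

Section hilbert.
Context (R : realType) (K : lmodType (complex R)) (ip : K -> K -> complex R).
Hypothesis hK : is_hilbert ip.

Let ip_lin c x y z : ip (c *: x + y) z = c * ip x z + ip y z.
Proof. by case: hK => + _; apply. Qed.

Let ip_sym x y : ip y x = (ip x y)^*.
Proof. by case: hK => _ [+ _]; apply. Qed.

Let ip_ge0 x : 0 <= ip x x.
Proof. by case: hK => _ [_ [+ _]]; apply. Qed.

Let ip_real x : ip x x = (hnorm2 ip x)%:C%C.
Proof. by rewrite [LHS]complexE (ger0_Im (ip_ge0 x)) mulr0 addr0. Qed.

Lemma hnorm2_ge0 x : 0 <= hnorm2 ip x.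
Proof. by have := ip_ge0 x; rewrite lecE => /andP[]. Qed.

Let ipB x y z : ip (x - y) z = ip x z - ip y z.
Proof. by rewrite addrC -scaleN1r ip_lin mulN1r addrC. Qed.

Let ipBr x y z : ip z (x - y) = ip z x - ip z y.
Proof. by rewrite ip_sym ipB rmorphB /= -!ip_sym. Qed.

Lemma cauchy_schwarz x y : cabs2 (ip x y) <= hnorm2 ip x * hnorm2 ip y.
Proof.
have [y0|y0] := eqVneq (hnorm2 ip y) 0.
  have -> : y = 0 by case: hK => _ [_ [_ [+ _]]]; apply; rewrite ip_real y0.
  have -> : ip x 0 = 0 by rewrite -(subrr 0) ipBr subrr.
  by rewrite /cabs2 /= expr0n addr0 mulr_ge0 // hnorm2_ge0.
have yp : 0 < hnorm2 ip y by rewrite lt_neqAle eq_sym y0 hnorm2_ge0.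
set a := ip x y; set t := hnorm2 ip y.
(* With t = |y|^2 and a = <x, y> this squared norm equals t (t |x|^2 - |a|^2). *)
have := hnorm2_ge0 (t%:C%C *: x + (- a) *: y).
have ipr z u v (c : complex R) : ip z (c *: u + v) = c^* * ip z u + ip z v.
  by rewrite ip_sym ip_lin rmorphD rmorphM /= -!ip_sym.
have ipZ z v (c : complex R) : ip (c *: v) z = c * ip v z.
  have ip0 : ip 0 z = 0 by rewrite -(subrr 0) ipB subrr.
  by rewrite -[_ *: v]addr0 ip_lin ip0 addr0.
have ipZr z v (c : complex R) : ip z (c *: v) = c^* * ip z v.
  by rewrite ip_sym ipZ rmorphM /= -ip_sym.
rewrite /hnorm2 ip_lin ipZ !ipr !ipZr (ip_sym x y) !ip_real -/a -/t.
rewrite !(ReD, ReM, ImM, Re_conj, Im_conj, ImD) /=.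
case: a => [p q] /=; rewrite /cabs2 /= -/(hnorm2 ip x).
move=> H; have {H} : 0 <= t * (t * hnorm2 ip x - (p ^+ 2 + q ^+ 2)).
  by apply: le_trans H _; rewrite le_eqVlt; apply/orP; left; apply/eqP; ring.
by rewrite pmulr_rge0 // subr_ge0 mulrC.
Qed.

(** Continuity of the inner product in its second argument; it carries the adjoint relation to the
    limit in the proof of closedness. *)
Lemma ip_limit_eq (u v : nat -> K) x y p q :
  (forall e, 0 < e -> exists M, forall n, (M <= n)%N -> hnorm2 ip (u n - x) < e) ->
  (forall e, 0 < e -> exists M, forall n, (M <= n)%N -> hnorm2 ip (v n - y) < e) ->
  (forall n, ip p (u n) = ip q (v n)) -> ip p x = ip q y.
Proof.
move=> ux vy uv; apply/eqP; rewrite -subr_eq0; apply/eqP/cabs2_eq0.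
apply/eqP; rewrite eq_le cabs2_ge0 andbT; apply/ler_addgt0Pr => e e0; rewrite add0r.
(* The two Cauchy-Schwarz bounds add up to (s - 1) (e / s); the added 1 keeps [s] positive when p =
   q = 0. *)
pose s := 2 * hnorm2 ip p + 2 * hnorm2 ip q + 1.
have s0 : 0 < s by rewrite /s; have := hnorm2_ge0 p; have := hnorm2_ge0 q; lra.
have es0 : 0 < e / s by rewrite divr_gt0.
have [M MP] := ux _ es0; have [N NP] := vy _ es0.
have {MP}un := MP (maxn M N) (leq_maxl _ _); have {NP}vn := NP (maxn M N) (leq_maxr _ _).
set n := maxn M N in un vn.
have -> : ip p x - ip q y = ip q (v n - y) + - ip p (u n - x).
  by rewrite !ipBr uv; ring.
apply: (le_trans (cabs2D_le _ _)).
have cabs2N (z : complex R) : cabs2 (- z) = cabs2 z.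
  by case: z => z1 z2; rewrite /cabs2 /= !sqrrN.
rewrite cabs2N.
have h1 := cauchy_schwarz q (v n - y); have h2 := cauchy_schwarz p (u n - x).
apply: (@le_trans _ _ (2 * (hnorm2 ip q * (e / s)) + 2 * (hnorm2 ip p * (e / s)))).
  by rewrite lerD // ler_wpM2l // (le_trans h1, le_trans h2) // ler_wpM2l ?hnorm2_ge0 // ltW.
have -> : 2 * (hnorm2 ip q * (e / s)) + 2 * (hnorm2 ip p * (e / s)) = (s - 1) * (e / s).
  by rewrite /s; ring.
apply: (@le_trans _ _ (s * (e / s))); first by rewrite ler_wpM2r ?(ltW es0) //; lra.
by rewrite mulrCA mulfV ?mulr1 // gt_eqF.
Qed.

End hilbert.

Section L2_hilbert.
Context (d : measure_display) (T : measurableType d) (R : realType).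
Context (nu : {measure set T -> \bar R}).
Local Notation C := (complex R).

(** The squared modulus is additive over real and imaginary parts, so these converge separately. *)
Lemma L2_complete (u : nat -> T -> C) : (forall n, L2c nu (u n)) ->
  (forall e : R, 0 < e -> exists N, forall m n, (N <= m)%N -> (N <= n)%N ->
     (\int[nu]_x (cabs2 (u m x - u n x))%:E < e%:E)%E) ->
  exists2 l, L2c nu l &
  forall e : R, 0 < e -> exists N, forall n, (N <= n)%N ->
     (\int[nu]_x (cabs2 (u n x - l x))%:E < e%:E)%E.
Proof.
move=> Lu cu.
have mu_ n : cmeasurable (u n) := L2c_cmeasurable (Lu n).
have split2 (F G : T -> C) : cmeasurable F -> cmeasurable G ->
    (\int[nu]_x (cabs2 (F x - G x))%:E =
     \int[nu]_x ((complex.Re (F x) - complex.Re (G x)) ^+ 2)%:E +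
     \int[nu]_x ((complex.Im (F x) - complex.Im (G x)) ^+ 2)%:E)%E.
  move=> [rF iF] [rG iG]; rewrite -ge0_integralD //.
  - apply: eq_integral => x _; rewrite /cabs2 -EFinD.
    by case: (F x) (G x) => ? ? [].
  - by move=> x _; rewrite lee_fin sqr_ge0.
  - by apply/measurable_EFinP; apply: measurable_funX; exact: measurable_funB.
  - by move=> x _; rewrite lee_fin sqr_ge0.
  - by apply/measurable_EFinP; apply: measurable_funX; exact: measurable_funB.
have i0 (f : T -> R) : (0 <= \int[nu]_x (f x ^+ 2)%:E)%E.
  by apply: integral_ge0 => x _; rewrite lee_fin sqr_ge0.
have [|g mg gP] := @l2_complete _ _ _ nu (fun n x => complex.Re (u n x)) (fun n => (mu_ n).1).
  move=> e e0; have [N NP] := cu e e0; exists N => m n Nm Nn.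
  by apply: le_lt_trans (NP m n Nm Nn); rewrite split2 // leeDl.
have [|h mh hP] := @l2_complete _ _ _ nu (fun n x => complex.Im (u n x)) (fun n => (mu_ n).2).
  move=> e e0; have [N NP] := cu e e0; exists N => m n Nm Nn.
  by apply: le_lt_trans (NP m n Nm Nn); rewrite split2 // leeDr.
pose l x := Complex (g x) (h x).
have ml : cmeasurable l by [].
have lP e : 0 < e -> exists N, forall n, (N <= n)%N ->
     (\int[nu]_x (cabs2 (u n x - l x))%:E < e%:E)%E.
  move=> e0; have e20 : 0 < e / 2 by rewrite divr_gt0.
  have [N NP] := gP _ e20; have [M MP] := hP _ e20; exists (maxn N M) => n.
  rewrite geq_max => /andP[/NP h1 /MP h2].
  by rewrite split2 // (_ : e = e / 2 + e / 2) ?EFinD ?lteD //; lra.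
exists l => //.
have [N /(_ N (leqnn N)) NP] := lP 1 ltr01.
have LlB : L2c nu (fun x => u N x - l x).
  have mB : cmeasurable (fun x => u N x - l x).
    apply: cmeasurableD => //.
    rewrite (_ : (fun x => _) = (fun x => (-1) * l x)).
      by apply: cmeasurableM => //; exact: cmeasurable_cst.
    by apply/funext => x; rewrite mulN1r.
  split; first exact: mB.1; split; first exact: mB.2.
  by apply: lt_trans NP _; rewrite ltry.
(* l = u_N - (u_N - l) is a difference of square-integrable functions. *)
have := L2cD (Lu N) (L2cZ (-1) LlB).
by apply: eq_L2c => x; rewrite mulN1r opprB addrCA subrr addr0.
Qed.

(** The quotient by the functions that vanish almost everywhere. Through [pi] and [rho], statements
    about vectors become statements about functions up to null sets. *)
Lemma L2_hilbert : exists (K : lmodType C) (ip : K -> K -> C)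
    (pi : (T -> C) -> K) (rho : K -> T -> C),
  [/\ is_hilbert ip,
      (forall u, L2c nu (rho u)) /\ (forall u, pi (rho u) = u),
      forall (c : C) F G, L2c nu F -> L2c nu G ->
        pi (fun x => c * F x + G x) = c *: pi F + pi G,
      forall F G, L2c nu F -> L2c nu G ->
        pi F = pi G <-> {ae nu, forall x, F x = G x} &
      forall F G, L2c nu F -> L2c nu G -> ip (pi F) (pi G) = l2ip nu F G].
Proof.
pose E : lmodType C := T -> C^o.
pose Z (F : E) := {ae nu, forall x, F x = 0}.
have Plin (c : C) (F G : E) : L2c nu F -> L2c nu G -> L2c nu (c *: F + G).
  by move=> LF LG; exact: (L2cD (L2cZ c LF) LG).
have Z0 : Z 0 by exact: aeW.
have Zlin (c : C) F G : Z F -> Z G -> Z (c *: F + G).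
  move=> F0 G0; have z0 (a b : C) : a = 0 -> b = 0 -> c * a + b = 0.
    by move=> -> ->; rewrite mulr0 addr0.
  by apply: filterS2 F0 G0 => x; exact: z0.
have [K [pi [rho [Prho pirho pilin pieq]]]] :=
  @lmod_quotient C E (L2c nu) Z (L2c0 nu) Plin Z0 Zlin.
have LB (F G : T -> C) : L2c nu F -> L2c nu G -> L2c nu (fun x => F x - G x).
  move=> LF LG; have := L2cD LF (L2cZ (-1) LG).
  by apply: eq_L2c => x; rewrite mulN1r.
have piae (F G : T -> C) : L2c nu F -> L2c nu G ->
    pi F = pi G <-> {ae nu, forall x, F x = G x}.
  move=> LF LG; split=> [/(pieq _ _ LF LG)|FG].
    by apply: filterS => x; exact: subr0_eq.
  apply/pieq => //.
  have s0 (a b' : C) : a = b' -> a - b' = 0 by move=> ->; rewrite subrr.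
  by apply: filterS FG => x; exact: s0.
have rhopi (F : T -> C) : L2c nu F -> {ae nu, forall x, rho (pi F) x = F x}.
  by move=> LF; apply/piae.
pose ip u v := l2ip nu (rho u) (rho v).
have ippi F G : L2c nu F -> L2c nu G -> ip (pi F) (pi G) = l2ip nu F G.
  move=> LF LG; apply: l2ip_ae; try exact: rhopi.
  - exact: L2c_cmeasurable (Prho _).
  - exact: L2c_cmeasurable LF.
  - exact: L2c_cmeasurable (Prho _).
  - exact: L2c_cmeasurable LG.
have norm_pi F : L2c nu F -> (hnorm2 ip (pi F))%:E = (\int[nu]_x (cabs2 (F x))%:E)%E.
  move=> LF; rewrite /hnorm2 ippi // l2ip_self // fineK // ge0_fin_numE.
    by case: LF => _ [].
  by apply: integral_ge0 => x _; rewrite lee_fin cabs2_ge0.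
have pilinT (c : C) (F G : T -> C) : L2c nu F -> L2c nu G ->
    pi (fun x => c * F x + G x) = c *: pi F + pi G := pilin c F G.
have piB (F G : T -> C) : L2c nu F -> L2c nu G -> pi (fun x => F x - G x) = pi F - pi G.
  move=> LF LG; rewrite -[RHS]addrC -scaleN1r -pilinT //; congr pi.
  by apply/funext => x; rewrite mulN1r addrC.
exists K, ip, pi, rho; split; [|by []|exact: pilinT|exact: piae|exact: ippi].
split; [|split; [|split; [|split]]].
- move=> c u v w; rewrite -[u]pirho -[v]pirho -[w]pirho -pilinT // !ippi //.
    by rewrite l2ip_lin.
  exact: (Plin c).
- by move=> u v; exact: l2ip_sym.
- move=> u; rewrite /ip l2ip_self // ler0c fine_ge0 // integral_ge0 // => x _.
  by rewrite lee_fin cabs2_ge0.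
- move=> u; rewrite /ip l2ip_self // => /(congr1 (@complex.Re R)) /= i0.
  have pi0 : pi (fun=> 0) = 0.
    have := piB _ _ (L2c0 nu) (L2c0 nu); rewrite [X in pi (fun=> X)]subrr => ->.
    exact: subrr.
  rewrite -[u]pirho -pi0; apply/piae => //; first exact: L2c0.
  apply: L2c_null; first exact: L2c_cmeasurable (Prho u).
  rewrite -[LHS]fineK ?i0 // ge0_fin_numE.
    by case: (Prho u) => _ [].
  by apply: integral_ge0 => x _; rewrite lee_fin cabs2_ge0.
- move=> u cu; have [|l Ll lP] := @L2_complete (fun n => rho (u n)) (fun n => Prho _).
    move=> e e0; have [N NP] := cu e e0; exists N => m n Nm Nn.
    rewrite -norm_pi; last exact: LB.
    by rewrite piB // !pirho lte_fin NP.
  exists (pi l) => e e0; have [N NP] := lP e e0; exists N => n Nn.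
  rewrite -lte_fin -[u n]pirho -piB // norm_pi; last exact: LB.
  exact: NP.
Qed.

End L2_hilbert.

(** * Weighted composition operators *)

Section real_multiplier.
Context (d : measure_display) (T : measurableType d) (R : realType).
Context (nu : {measure set T -> \bar R}).
Local Notation C := (complex R).
Implicit Types (F G H : T -> C) (b : T -> R).

Lemma cmeasurable_rmul b F : measurable_fun setT b -> cmeasurable F ->
  cmeasurable (fun x => (b x)%:C%C * F x).
Proof. by move=> mb mF; apply: cmeasurableM => //; exact: cmeasurable_real. Qed.

Lemma L2c_rmul b F (M : R) : measurable_fun setT b -> (forall x, `|b x| <= M) ->
  L2c nu F -> L2c nu (fun x => (b x)%:C%C * F x).
Proof.
move=> mb bM LF; apply: (L2c_le (G := F) (c := M ^+ 2)) => //.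
- by rewrite sqr_ge0.
- by apply: cmeasurable_rmul => //; exact: L2c_cmeasurable LF.
- move=> x; rewrite cabs2M cabs2_real ler_wpM2r ?cabs2_ge0 //.
  by rewrite -real_normK ?num_real // lerXn2r ?nnegrE // (le_trans _ (bM x)).
Qed.

(** Cutting off to b <= n makes multiplication by an unbounded weight bounded. Such cut-offs supply
    the test vectors for the adjoint and the density of the domain. *)
Definition trunc_at b (n : nat) : T -> R := \1_[set x | b x <= n%:R].

Lemma measurable_trunc b n : measurable_fun setT b -> measurable_fun setT (trunc_at b n).
Proof.
move=> mb; apply: measurable_indic; rewrite -[X in measurable X]setTI.
rewrite (_ : [set x | _] = b @^-1` `]-oo, n%:R]); first exact: mb.
by apply/seteqP; split => x /=; rewrite in_itv.
Qed.

Lemma trunc_at_le1 b n x : `|trunc_at b n x| <= 1.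
Proof. by rewrite /trunc_at indicE; case: (_ \in _); rewrite ?normr1 ?normr0. Qed.

Lemma trunc_atM b n x : trunc_at b n x * trunc_at b n x = trunc_at b n x.
Proof. by rewrite /trunc_at indicE; case: (_ \in _); rewrite ?mulr1 ?mulr0. Qed.

Lemma trunc_at_mul_le b n x : 0 <= b x -> `|b x * trunc_at b n x| <= n%:R.
Proof.
move=> b0; rewrite /trunc_at indicE; have [bn|bn] := leP (b x) n%:R.
  by rewrite mem_set // mulr1 ger0_norm.
by rewrite memNset ?mulr0 ?normr0 //= => /(lt_le_trans bn); rewrite ltxx.
Qed.

Lemma trunc_at_eventually b x : exists N, forall n, (N <= n)%N -> trunc_at b n x = 1.
Proof.
exists (Num.trunc `|b x|).+1 => n Nn; rewrite /trunc_at indicE mem_set //=.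
apply: (le_trans (ler_norm _)); have /andP[_ /ltW/le_trans] := Num.Theory.trunc_itv (normr_ge0 (b x)).
by apply; rewrite ler_nat.
Qed.

(** Dominated convergence with bound |F|^2: at each point the cut-off is eventually 1. *)
Lemma L2c_trunc_small b F (e : R) : measurable_fun setT b -> L2c nu F -> 0 < e ->
  exists n, (\int[nu]_x (cabs2 (F x - (trunc_at b n x)%:C%C * F x))%:E < e%:E)%E.
Proof.
move=> mb LF e0; have mF := L2c_cmeasurable LF.
pose G n x := F x - (trunc_at b n x)%:C%C * F x.
have GE n x : G n x = (1 - trunc_at b n x)%:C%C * F x.
  by rewrite /G rmorphB mulrBl mul1r.
have mG n : cmeasurable (G n).
  rewrite (_ : G n = fun x => (1 - trunc_at b n x)%:C%C * F x); last exact/funext.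
  apply: cmeasurable_rmul => //; apply: measurable_funB => //; exact: measurable_trunc.
have iF : nu.-integrable setT (fun x => (cabs2 (F x))%:E).
  apply/integrableP; split; first exact: measurable_cabs2E.
  under eq_integral do rewrite gee0_abs ?lee_fin ?cabs2_ge0 //.
  by case: LF => _ [].
have [] := @dominated_convergence _ _ _ nu setT measurableT
  (fun n x => (cabs2 (G n x))%:E) (cst 0%E) (fun x => (cabs2 (F x))%:E) _ _ _ iF _.
- by move=> n; exact: measurable_cabs2E.
- exact: measurable_cst.
- apply: aeW => x _; have [N NP] := trunc_at_eventually b x.
  apply: cvg_near_cst; exists N => // n /= /NP nE.
  by rewrite GE nE subrr cabs2M cabs2_real expr0n mul0r.
- apply: aeW => x n _; rewrite GE cabs2M cabs2_real abse_EFin lee_fin.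
  rewrite ger0_norm; last by rewrite mulr_ge0 ?sqr_ge0 ?cabs2_ge0.
  apply: ler_piMl; first exact: cabs2_ge0.
  by rewrite /trunc_at indicE; case: (_ \in _); rewrite ?subrr ?subr0 ?expr0n ?expr1n.
- move=> _ _; rewrite integral0 => cG.
  have /fine_cvgP[_ /cvgrPdist_lt /(_ e e0) [n _ /(_ n (leqnn n))]] := cG.
  rewrite /= sub0r normrN ger0_norm => [lt_e|]; last first.
    by rewrite fine_ge0 // integral_ge0 // => x _; rewrite lee_fin cabs2_ge0.
  exists n; rewrite -lte_fin fineK // in lt_e.
  rewrite ge0_fin_numE; last by apply: integral_ge0 => x _; rewrite lee_fin cabs2_ge0.
  have LG : L2c nu (G n).
    rewrite (_ : G n = fun x => (1 - trunc_at b n x)%:C%C * F x); last exact/funext.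
    apply: (@L2c_rmul _ _ 1) => //.
      by apply: measurable_funB => //; exact: measurable_trunc.
    move=> x; rewrite /trunc_at indicE; case: (_ \in _);
      by rewrite ?subrr ?subr0 ?normr0 ?normr1.
  by case: LG => _ [].
Qed.

End real_multiplier.

Section composition.
Context (d : measure_display) (T : measurableType d) (R : realType).
Context (nu : {measure set T -> \bar R}).
Local Notation C := (complex R).
Implicit Types (F G H : T -> C).
Context (phi : T -> T) (r : R).
Hypothesis mphi : measurable_fun setT phi.
Hypothesis r0 : 0 < r.
Hypothesis nuphi : forall E, measurable E -> nu (phi @^-1` E) = (r%:E * nu E)%E.

Lemma ge0_integral_comp (f : T -> \bar R) : measurable_fun setT f ->
  (forall x, 0 <= f x)%E -> (\int[nu]_x f (phi x) = r%:E * \int[nu]_x f x)%E.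
Proof.
move=> mf f0; rewrite -[LHS](ge0_integral_pushforward mphi nu measurableT mf) //.
rewrite -(ge0_integral_mscale _ _ (NngNum (ltW r0))) //.
by apply: eq_measure_integral => E mE _; exact: nuphi.
Qed.

Lemma integral_comp (f : T -> \bar R) : nu.-integrable setT f ->
  (\int[nu]_x f (phi x) = r%:E * \int[nu]_x f x)%E.
Proof.
move=> intf; have mf := measurable_int _ intf.
rewrite [LHS]integralE [in RHS]integralE.
rewrite -[(fun x => f (phi x))]/(f \o phi) funepos_comp funeneg_comp.
rewrite [X in (X - _)%E](ge0_integral_comp (measurable_funepos mf)) //.
rewrite [X in (_ - X)%E](ge0_integral_comp (measurable_funeneg mf)) //.
apply/esym/muleBr => //; apply: fin_num_adde_defl; rewrite fin_numN.
exact: integrable_neg_fin_num.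
Qed.

Lemma cmeasurable_comp F : cmeasurable F -> cmeasurable (F \o phi).
Proof.
move=> [rF iF]; split.
  exact: (measurableT_comp rF mphi).
exact: (measurableT_comp iF mphi).
Qed.

Lemma L2c_comp F : L2c nu F -> L2c nu (F \o phi).
Proof.
move=> LF; have mF := L2c_cmeasurable LF; have [rF iF] := cmeasurable_comp mF.
split => //; split => //=.
rewrite (ge0_integral_comp (f := fun x => (cabs2 (F x))%:E)).
- by apply: lte_mul_pinfty => //; [rewrite lee_fin ltW|case: LF => _ []].
- exact: measurable_cabs2E.
- by move=> x; rewrite lee_fin cabs2_ge0.
Qed.

Lemma ae_comp (P : T -> Prop) : {ae nu, forall x, P x} -> {ae nu, forall x, P (phi x)}.
Proof.
move=> [A [mA A0 PA]]; exists (phi @^-1` A); split.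
- by rewrite -[X in measurable X]setTI; exact: mphi.
- by rewrite nuphi // A0 mule0.
- by move=> x /= nP; apply: PA.
Qed.

Lemma l2ip_comp F G : L2c nu F -> L2c nu G ->
  l2ip nu (F \o phi) (G \o phi) = r%:C%C * l2ip nu F G.
Proof.
move=> LF LG; have [iR iI] := cintegrable_mulJ LF LG.
apply/eqP; rewrite eq_complex ReM ImM /= !mul0r subr0 addr0.
have h (f : T -> R) : nu.-integrable setT (EFin \o f) ->
    \int[nu]_x f (phi x) = r * \int[nu]_x f x.
  move=> intf; rewrite /Rintegral (integral_comp intf) fineM //.
  exact: integrable_fin_num.
by apply/andP; split; apply/eqP; [exact: h iR|exact: h iI].
Qed.

End composition.

Section adjoint.
Context (d : measure_display) (T : measurableType d) (R : realType).
Context (nu : {measure set T -> \bar R}).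
Local Notation C := (complex R).
Implicit Types (F G H Z : T -> C).
Context (phi psi : T -> T) (b : T -> R) (r : R).
Hypothesis mphi : measurable_fun setT phi.
Hypothesis mpsi : measurable_fun setT psi.
Hypothesis phiK : cancel phi psi.
Hypothesis psiK : cancel psi phi.
Hypothesis r0 : 0 < r.
Hypothesis nuphi : forall E, measurable E -> nu (phi @^-1` E) = (r%:E * nu E)%E.
Hypothesis mb : measurable_fun setT b.
Hypothesis b0 : forall x, 0 < b x.
Hypothesis bphi : forall x, b (phi x) = b x.

Lemma nu_inverse E : measurable E -> nu (psi @^-1` E) = (r^-1%:E * nu E)%E.
Proof.
move=> mE; have mpE : measurable (psi @^-1` E).
  by rewrite -[X in measurable X]setTI; exact: mpsi.
have := nuphi mpE; rewrite -comp_preimage (_ : psi \o phi = id); last exact/funext.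
by rewrite preimage_id => ->; rewrite muleA -EFinM mulVf ?gt_eqF // mul1e.
Qed.

Lemma weight_psi x : b (psi x) = b x.
Proof. by rewrite -[in RHS](psiK x) bphi. Qed.

Definition wcomp F : T -> C := fun x => (b x)%:C%C * F (phi x).
(** The formal adjoint; the factor [r] comes from the change of variables by [phi]. *)
Definition wcomp_adj F : T -> C := fun x => (r * b x)%:C%C * F (psi x).

Lemma L2c_comp_psi F : L2c nu F -> L2c nu (F \o psi).
Proof.
have ri0 : 0 < r^-1 by rewrite invr_gt0.
exact: (L2c_comp mpsi ri0 nu_inverse).
Qed.

(** By invariance of b, [wcomp F] is (b F) o phi, and composition with [phi] or [psi] preserves
    square integrability. *)
Lemma L2c_wcomp F : L2c nu (fun x => (b x)%:C%C * F x) <-> L2c nu (wcomp F).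
Proof.
split=> [/(L2c_comp mphi r0 nuphi)|/L2c_comp_psi].
  by apply: eq_L2c => x /=; rewrite bphi.
by apply: eq_L2c => x; rewrite /wcomp /= psiK weight_psi.
Qed.

Lemma L2c_wcomp_adj F : L2c nu (fun x => (b x)%:C%C * F x) <-> L2c nu (wcomp_adj F).
Proof.
split=> [/L2c_comp_psi/(L2cZ (r%:C%C))|/(L2c_comp mphi r0 nuphi)/(L2cZ (r^-1)%:C%C)].
  apply: eq_L2c => x /=; rewrite weight_psi /wcomp_adj.
  by rewrite rmorphM mulrA.
apply: eq_L2c => x; rewrite /wcomp_adj /= phiK bphi rmorphM !mulrA.
by rewrite -rmorphM mulVf ?gt_eqF // mul1r.
Qed.

Lemma l2ip_rmul (m : T -> R) F G :
  l2ip nu (fun x => (m x)%:C%C * F x) G = l2ip nu F (fun x => (m x)%:C%C * G x).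
Proof.
congr cint; apply/funext => x.
have -> : ((m x)%:C%C * G x)^* = (m x)%:C%C * (G x)^*.
  by rewrite -[in RHS]conj_real -rmorphM.
by rewrite mulrA [F x * _]mulrC.
Qed.

Lemma l2ip_wcomp F G : L2c nu F -> L2c nu (fun x => (b x)%:C%C * G x) ->
  l2ip nu (wcomp F) G = l2ip nu F (wcomp_adj G).
Proof.
move=> LF LbG; rewrite /wcomp l2ip_rmul.
have -> : (fun x => (b x)%:C%C * G x) = (fun x => (b x)%:C%C * G (psi x)) \o phi.
  by apply/funext => x /=; rewrite phiK bphi.
have LbGp : L2c nu (fun x => (b x)%:C%C * G (psi x)).
  by move/L2c_comp_psi: LbG; apply: eq_L2c => x /=; rewrite weight_psi.
rewrite [LHS](l2ip_comp mphi r0 nuphi LF LbGp).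
have -> : wcomp_adj G = fun x => r%:C%C * ((b x)%:C%C * G (psi x)).
  by apply/funext => x; rewrite /wcomp_adj rmorphM mulrA.
by rewrite -(l2ip_rmul (fun=> r)) l2ipZ.
Qed.

(* The test vectors are [V n = 1_(b <= n) (Z - wcomp_adj G)]: on them the weight
   is bounded, and the hypothesis forces [<V n, V n> = 0]. *)
Lemma adjoint_char G Z : L2c nu G -> L2c nu Z ->
  (forall F, L2c nu F -> L2c nu (fun x => (b x)%:C%C * F x) ->
     l2ip nu (wcomp F) G = l2ip nu F Z) ->
  L2c nu (fun x => (b x)%:C%C * G x) /\ {ae nu, forall x, Z x = wcomp_adj G x}.
Proof.
move=> LG LZ adj; have mG := L2c_cmeasurable LG; have mZ := L2c_cmeasurable LZ.
have mW : cmeasurable (wcomp_adj G).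
  apply: (cmeasurable_rmul (b := fun x => r * b x)); first exact: measurable_funM.
  exact: (L2c_cmeasurable (L2c_comp_psi LG)).
(* The domain condition follows: [Z] is square integrable, hence so is [wcomp_adj G], hence so is b
   G by [L2c_wcomp_adj]. *)
suff aeZ : {ae nu, forall x, Z x = wcomp_adj G x}.
  by split => //; apply/L2c_wcomp_adj; exact: L2c_ae mW aeZ LZ.
pose t n := trunc_at b n.
have mt n : measurable_fun setT (t n) by exact: measurable_trunc.
have tphi n x : t n (phi x) = t n x.
  rewrite /t /trunc_at !indicE; congr (nat_of_bool _)%:R.
  by apply/idP/idP => /set_mem /= h; apply/mem_set; rewrite /= ?bphi // -bphi.
have tpsi n x : t n (psi x) = t n x by rewrite -[in RHS](psiK x) tphi.
have Ltb n F : L2c nu F -> L2c nu (fun x => (b x * t n x)%:C%C * F x).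
  move=> LF; apply: (L2c_rmul (M := n%:R)) => //; first exact: measurable_funM.
  by move=> x; apply: trunc_at_mul_le; exact: ltW.
have Lt n F : L2c nu F -> L2c nu (fun x => (t n x)%:C%C * F x).
  by move=> LF; apply: (L2c_rmul (M := 1)) => // x; exact: trunc_at_le1.
pose tG n x := (t n x)%:C%C * G x.
have LtG n : L2c nu (tG n) by exact: Lt.
have LbtG n : L2c nu (fun x => (b x)%:C%C * tG n x).
  by have := Ltb n _ LG; apply: eq_L2c => x; rewrite /tG rmorphM mulrA.
have LW n : L2c nu (wcomp_adj (tG n)) by apply/L2c_wcomp_adj.
pose V n x := (t n x)%:C%C * Z x - wcomp_adj (tG n) x.
have VE n x : V n x = (t n x)%:C%C * (Z x - wcomp_adj G x).
  by rewrite /V /wcomp_adj /tG tpsi; ring.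
have LV n : L2c nu (V n).
  rewrite /V; apply: L2cD; first exact: Lt.
  by have := L2cZ (-1) (LW n); apply: eq_L2c => x; rewrite mulN1r.
have tV n x : (t n x)%:C%C * V n x = V n x.
  by rewrite VE mulrA -rmorphM trunc_atM.
have LbV n : L2c nu (fun x => (b x)%:C%C * V n x).
  have := Ltb n _ (LV n); apply: eq_L2c => x.
  by rewrite rmorphM -mulrA tV.
have V0 n : l2ip nu (V n) (V n) = 0.
  have h1 : l2ip nu (V n) Z = l2ip nu (V n) (fun x => (t n x)%:C%C * Z x).
    by rewrite -l2ip_rmul; congr l2ip; apply/funext => x; rewrite tV.
  (* [V n] lies in the domain, so the hypothesis turns <V n, Z> into <wcomp (V n), G>; the cut-off,
     invariant under [phi], then moves onto G. *)
  have h2 : l2ip nu (V n) Z = l2ip nu (V n) (wcomp_adj (tG n)).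
    rewrite -adj // -l2ip_wcomp // -[in RHS]/(tG n) /tG -l2ip_rmul; congr l2ip.
    by apply/funext => x; rewrite /wcomp mulrCA -tphi tV.
  have LtZ := Lt n _ LZ.
  have h3 : V n = fun x => (-1) * wcomp_adj (tG n) x + (t n x)%:C%C * Z x.
    by apply/funext => x; rewrite mulN1r addrC.
  rewrite {1}h3 l2ip_lin // (l2ip_sym (LV n) (LW n)) (l2ip_sym (LV n) LtZ) -h1 -h2.
  by rewrite mulN1r addNr.
have aeV n : {ae nu, forall x, V n x = 0}.
  apply: L2c_null; first exact: L2c_cmeasurable (LV n).
  have := V0 n; rewrite l2ip_self // => /(congr1 (@complex.Re R)) /= fV0.
  have i0 : (0 <= \int[nu]_x (cabs2 (V n x))%:E)%E.
    by apply: integral_ge0 => x _; rewrite lee_fin cabs2_ge0.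
  rewrite -[LHS]fineK ?fV0 // ge0_fin_numE //.
  by case: (LV n) => _ [].
have aeVn : {ae nu, forall x, forall n, V n x = 0}.
  by apply: ae_foralln.
apply: filterS aeVn => x Vx0; have [N /(_ N (leqnn N)) tN] := trunc_at_eventually b x.
have := Vx0 N; rewrite VE /t tN mul1r => /eqP; by rewrite subr_eq0 => /eqP.
Qed.

End adjoint.

Section weighted_composition.
Context (d : measure_display) (T : measurableType d) (R : realType).
Context (nu : {measure set T -> \bar R}).
Local Notation C := (complex R).
Implicit Types (F G H Z : T -> C).
Context (phi psi : T -> T) (b : T -> R) (r : R).
Hypothesis mphi : measurable_fun setT phi.
Hypothesis mpsi : measurable_fun setT psi.
Hypothesis phiK : cancel phi psi.
Hypothesis psiK : cancel psi phi.
Hypothesis r0 : 0 < r.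
Hypothesis nuphi : forall E, measurable E -> nu (phi @^-1` E) = (r%:E * nu E)%E.
Hypothesis mb : measurable_fun setT b.
Hypothesis b0 : forall x, 0 < b x.
Hypothesis bphi : forall x, b (phi x) = b x.

Context (K : lmodType C) (ip : K -> K -> C) (pi : (T -> C) -> K) (rho : K -> T -> C).
Hypothesis hK : is_hilbert ip.
Hypothesis Lrho : forall u, L2c nu (rho u).
Hypothesis pirho : forall u, pi (rho u) = u.
Hypothesis pilin : forall (c : C) F G, L2c nu F -> L2c nu G ->
  pi (fun x => c * F x + G x) = c *: pi F + pi G.
Hypothesis pieq : forall F G, L2c nu F -> L2c nu G ->
  pi F = pi G <-> {ae nu, forall x, F x = G x}.
Hypothesis ippi : forall F G, L2c nu F -> L2c nu G -> ip (pi F) (pi G) = l2ip nu F G.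

Let bpsi := weight_psi psiK bphi.

(** By [L2c_wcomp] this is the maximal domain, where the weighted composition stays in L^2. *)
Definition wdom : set K := [set u | L2c nu (fun x => (b x)%:C%C * rho u x)].
Definition wop (u : K) : K := pi (wcomp phi b (rho u)).

Let wcompP F : L2c nu (fun x => (b x)%:C%C * F x) -> L2c nu (wcomp phi b F).
Proof. by move/(L2c_wcomp mphi mpsi phiK psiK r0 nuphi bphi). Qed.

Let wadjP F : L2c nu (fun x => (b x)%:C%C * F x) -> L2c nu (wcomp_adj psi b r F).
Proof. by move/(L2c_wcomp_adj mphi mpsi phiK psiK r0 nuphi bphi). Qed.

Let mbF F : L2c nu F -> cmeasurable (fun x => (b x)%:C%C * F x).
Proof. by move=> LF; apply: cmeasurable_rmul => //; exact: L2c_cmeasurable LF. Qed.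

Lemma wdom_pi F : L2c nu F -> wdom (pi F) <-> L2c nu (fun x => (b x)%:C%C * F x).
Proof.
move=> LF; have rF : {ae nu, forall x, rho (pi F) x = F x} by apply/pieq.
split; apply: L2c_ae; try exact: mbF.
  by apply: filterS rF => x ->.
by apply: filterS rF => x ->.
Qed.

(** The choice of representative does not matter because [phi] pulls null sets back to null sets. *)
Lemma wop_pi F : L2c nu F -> L2c nu (fun x => (b x)%:C%C * F x) ->
  wop (pi F) = pi (wcomp phi b F).
Proof.
move=> LF LbF; apply/pieq.
- by apply: wcompP; exact/wdom_pi.
- exact: wcompP.
have rF : {ae nu, forall x, rho (pi F) x = F x} by apply/pieq.
by apply: filterS (ae_comp mphi nuphi rF) => x; rewrite /wcomp => ->.
Qed.

(** The Hilbert-space adjoint is exactly the formal one, with the same domain as the operator: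
    [adjoint_char] gives one direction, [l2ip_wcomp] the other. *)
Lemma wop_adjP G z : L2c nu G -> adj_rel ip wdom wop (pi G) z <->
  L2c nu (fun x => (b x)%:C%C * G x) /\ z = pi (wcomp_adj psi b r G).
Proof.
move=> LG; split=> [adj|[LbG ->] u Du].
  have [|LbG aez] := adjoint_char mphi mpsi phiK psiK r0 nuphi mb b0 bphi LG (Lrho z).
    move=> F LF LbF; rewrite -ippi //; last exact: wcompP.
    by rewrite -wop_pi // -ippi // pirho; apply: adj; exact/wdom_pi.
  by split => //; rewrite -[LHS]pirho; apply/pieq => //; exact: wadjP.
rewrite /wop -[X in ip X _ = _]pirho -[in RHS](pirho u) !ippi //.
- rewrite -(l2ip_wcomp mphi mpsi phiK psiK r0 nuphi bphi (Lrho u) LbG).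
  apply: l2ip_ae.
  + exact: L2c_cmeasurable (Lrho _).
  + exact: L2c_cmeasurable (wcompP Du).
  + exact: L2c_cmeasurable LG.
  + exact: L2c_cmeasurable LG.
  + by apply/pieq => //; exact: wcompP.
  + exact: aeW.
- exact: wadjP.
Qed.

Lemma hnorm2_pi F : L2c nu F -> (hnorm2 ip (pi F))%:E = (\int[nu]_x (cabs2 (F x))%:E)%E.
Proof.
move=> LF; rewrite /hnorm2 ippi // l2ip_self // fineK // ge0_fin_numE.
  by case: LF => _ [].
by apply: integral_ge0 => x _; rewrite lee_fin cabs2_ge0.
Qed.

Let wcomp_lin c F G : wcomp phi b (fun x => c * F x + G x) =
  fun x => c * wcomp phi b F x + wcomp phi b G x.
Proof. by apply/funext => x; rewrite /wcomp; ring. Qed.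

Let dom_lin c F G : L2c nu (fun x => (b x)%:C%C * F x) -> L2c nu (fun x => (b x)%:C%C * G x) ->
  L2c nu (fun x => (b x)%:C%C * (c * F x + G x)).
Proof.
move=> LF LG; have := L2cD (L2cZ c LF) LG.
by apply: eq_L2c => x; ring.
Qed.

(** The equality of the domains of adj(N) N and N adj(N). The functions are b^2 (F o phi) and r b^2
    (F o psi), which differ by two compositions and a constant. *)
Let b2P F : L2c nu (fun x => (b x)%:C%C * wcomp phi b F x) <->
  L2c nu (fun x => (b x)%:C%C * wcomp_adj psi b r F x).
Proof.
split=> [/(L2c_comp_psi mpsi phiK r0 nuphi)/(L2c_comp_psi mpsi phiK r0 nuphi)/(L2cZ r%:C%C)|].
  by apply: eq_L2c => x; rewrite /= /wcomp /wcomp_adj !bpsi psiK rmorphM; ring.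
move/(L2c_comp mphi r0 nuphi)/(L2c_comp mphi r0 nuphi)/(L2cZ (r^-1)%:C%C).
apply: eq_L2c => x; rewrite /= /wcomp /wcomp_adj !bphi phiK rmorphM.
have : (r^-1)%:C%C * r%:C%C = 1 :> C by rewrite -rmorphM mulVf ?gt_eqF.
move=> rr; rewrite -[RHS]mul1r -rr; ring.
Qed.

(* The adjoint of the operator is again a weighted composition operator, with
   map [psi], weight [r b] and constant [r^-1]; [adjoint_char] applied to it
   identifies the limit [y] with [wop x]. *)
Lemma wop_closed (u : nat -> K) x y : (forall n, wdom (u n)) ->
  (forall e, 0 < e -> exists M, forall n, (M <= n)%N -> hnorm2 ip (u n - x) < e) ->
  (forall e, 0 < e -> exists M, forall n, (M <= n)%N -> hnorm2 ip (wop (u n) - y) < e) ->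
  wdom x /\ wop x = y.
Proof.
move=> Du ux wy.
have ri0 : 0 < r^-1 by rewrite invr_gt0.
have rb0 z : 0 < r * b z by rewrite mulr_gt0.
have mrb : measurable_fun setT (fun z => r * b z) by exact: measurable_funM.
have rbpsi z : r * b (psi z) = r * b z by rewrite bpsi.
have nupsi := nu_inverse mpsi phiK r0 nuphi.
have LbF (F : T -> C) : L2c nu (fun z => (r * b z)%:C%C * F z) -> L2c nu (fun z => (b z)%:C%C * F z).
  move/(L2cZ (r^-1)%:C%C); apply: eq_L2c => z.
  by rewrite !rmorphM !mulrA -rmorphM mulVf ?gt_eqF // mul1r.
have [|LbX aey] := adjoint_char mpsi mphi psiK phiK ri0 nupsi mrb rb0 rbpsi (Lrho x) (Lrho y).
  move=> F LF /LbF LF'.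
  rewrite -[wcomp _ _ _]/(wcomp_adj psi b r F) -ippi //; last exact: wadjP.
  (* Each [u n] pairs with the adjoint vector as [wop (u n)] pairs with [pi F]; in the limit the
     same holds for [x] and [y]. *)
  rewrite pirho -ippi // pirho; apply: (ip_limit_eq hK ux wy) => n.
  have [_ h] := wop_adjP (pi (wcomp_adj psi b r F)) LF.
  have hn := h (conj LF' erefl) (u n) (Du n).
  case: hK => _ [hsym _].
  by rewrite (hsym (u n)) (hsym (wop (u n))) hn.
have Dx : wdom x by exact: LbF.
split=> //; rewrite -[RHS]pirho; apply/pieq => //; first exact: wcompP.
apply: filterS aey => z ->; rewrite /wcomp_adj /wcomp.
by rewrite mulrA mulVf ?gt_eqF // mul1r.
Qed.

Lemma wop_normal : normal_op ip wdom wop.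
Proof.
have pi0 : pi (fun=> 0) = 0.
  have := pilin (-1) (L2c0 nu) (L2c0 nu); rewrite scaleN1r addNr => <-; congr pi.
  by apply/funext => x; rewrite mulr0 addr0.
split; [|split; [|split; [|split; [|split]]]].
- rewrite -pi0; apply/wdom_pi; first exact: L2c0.
  by apply: eq_L2c (L2c0 nu) => x; rewrite mulr0.
- move=> c x y Dx Dy; have LxLy : L2c nu (fun z => c * rho x z + rho y z).
    by apply: L2cD => //; exact: L2cZ.
  have xyE : c *: x + y = pi (fun z => c * rho x z + rho y z) by rewrite pilin // !pirho.
  rewrite xyE; split; first by apply/wdom_pi => //; exact: dom_lin.
  rewrite wop_pi //; last exact: dom_lin.
  by rewrite wcomp_lin pilin //; exact: wcompP.
(* Cut-offs of [x] lie in the domain and approximate it. *)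
- move=> x e e0; have [n nP] := L2c_trunc_small mb (Lrho x) e0.
  have Lt : L2c nu (fun z => (trunc_at b n z)%:C%C * rho x z).
    by apply: (L2c_rmul (M := 1)) => // [|z]; [exact: measurable_trunc|exact: trunc_at_le1].
  exists (pi (fun z => (trunc_at b n z)%:C%C * rho x z)); split.
    apply/wdom_pi => //.
    have := @L2c_rmul _ _ _ nu (fun z => b z * trunc_at b n z) (rho x) n%:R.
    move=> /(_ _ _ (Lrho x)) H; apply: eq_L2c (H _ _) => [z||z].
    + by rewrite rmorphM mulrA.
    + by apply: measurable_funM => //; exact: measurable_trunc.
    + by apply: trunc_at_mul_le; exact: ltW.
  have -> : x - pi (fun z => (trunc_at b n z)%:C%C * rho x z) =
      pi (fun z => -1 * ((trunc_at b n z)%:C%C * rho x z) + rho x z).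
    by rewrite pilin // pirho scaleN1r addrC.
  rewrite -lte_fin hnorm2_pi; last by apply: L2cD => //; exact: L2cZ.
  by move: nP; under eq_integral do rewrite addrC -mulN1r.
- exact: wop_closed.
- move=> x; split.
    move=> [Dx [w aw]]; have [+ _] := (wop_adjP w (wcompP Dx)).1 aw.
    move=> /b2P LbA; exists (pi (wcomp_adj psi b r (rho x))); split.
      by rewrite -{1}[x]pirho; apply/wop_adjP.
    by apply/wdom_pi => //; exact: wadjP.
  move=> [z [az Dz]]; have := az; rewrite -{1}[x]pirho => /(wop_adjP _ (Lrho x))[Dx zE].
  split => //; exists (pi (wcomp_adj psi b r (wcomp phi b (rho x)))).
  apply/wop_adjP; first exact: wcompP.
  split => //; apply/b2P; rewrite zE in Dz.
  exact: (wdom_pi (wadjP Dx)).1 Dz.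
- move=> x w z Dx aw az Dz.
  have [LbN ->] := (wop_adjP w (wcompP Dx)).1 aw.
  have := az; rewrite -{1}[x]pirho => /(wop_adjP _ (Lrho x))[_ zE].
  rewrite zE wop_pi; last first.
  + by rewrite zE in Dz; exact: (wdom_pi (wadjP Dx)).1 Dz.
  + exact: wadjP.
  (* Both products are multiplication by r b^2. *)
  congr pi; apply/funext => t; rewrite /wcomp_adj /wcomp bphi bpsi phiK psiK !rmorphM.
  ring.
Qed.

End weighted_composition.

(** * Expansion of the density *)

Section density.
Local Open Scope ereal_scope.
Context (d : measure_display) (T : measurableType d) (R : realType).
Context (w mu : {measure set T -> \bar R}) (g : T -> R).
Hypothesis mg : measurable_fun setT g.
Hypothesis g0 : forall x, (0 <= g x)%R.
Hypothesis mu_density : forall E, measurable E -> mu E = \int[w]_(x in E) (g x)%:E.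

Import HBNNSimple.

Let integral_density_nnsfun (h : {nnsfun T >-> R}) :
  \int[mu]_x (h x)%:E = \int[w]_x ((h x)%:E * (g x)%:E).
Proof.
under [LHS]eq_integral do rewrite fimfunE -fsumEFin//.
rewrite [LHS]ge0_integral_fsum//; last 2 first.
  - by move=> r; exact/measurable_EFinP/measurableT_comp.
  - by move=> n x _; rewrite EFinM nnfun_muleindic_ge0.
under [RHS]eq_integral.
  move=> x xD; rewrite fimfunE -fsumEFin// muleC ge0_mule_fsumr; last first.
    by move=> r; rewrite EFinM nnfun_muleindic_ge0.
  over.
rewrite [RHS]ge0_integral_fsum//; last 2 first.
  - by move=> r; apply: emeasurable_funM; apply/measurable_EFinP => //; exact: measurableT_comp.
  - by move=> n x _; apply: mule_ge0; [rewrite lee_fin|rewrite EFinM nnfun_muleindic_ge0].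
apply: eq_fsbigr => r _; rewrite integralZl_indic_nnsfun//= integral_indic // setIT.
have mr : measurable (h @^-1` [set r]) by [].
rewrite mu_density // integral_mkcond.
have [r0|r0] := leP 0%R r; last first.
  have h0 : h @^-1` [set r] = set0.
    by apply/seteqP; split => // x /= hx; move: r0; rewrite -hx ltNge fun_ge0.
  rewrite h0 (_ : _ \_ set0 = cst 0); last by apply/funext => x; rewrite patchE memNset.
  rewrite integral0 mule0; apply/esym/integral0_eq => x _.
  by rewrite indicE memNset // mulr0 mule0.
rewrite -ge0_integralZl //.
- apply: eq_integral => x _; rewrite patchE indicE; case: ifPn => _.
    by rewrite mulr1 muleC.
  by rewrite mulr0 !mule0.
- apply/(measurable_restrict _ _ measurableT) => //; rewrite setTI.
  exact/measurable_EFinP/measurable_funTS.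
- by move=> x _; rewrite patchE; case: ifPn; rewrite ?lee_fin.
Qed.

(** The density is given on sets only; simple functions and monotone convergence extend it to
    integrands. *)
Lemma ge0_integral_density (f : T -> \bar R) : measurable_fun setT f ->
  (forall x, 0 <= f x) -> \int[mu]_x f x = \int[w]_x (f x * (g x)%:E).
Proof.
move=> mf f0; pose f_ := nnsfun_approx measurableT mf.
transitivity (limn (fun n => \int[mu]_x (f_ n x)%:E)).
  rewrite -monotone_convergence//=.
  - apply: eq_integral => x xD; apply/esym/cvg_lim => //=.
    exact: cvg_nnsfun_approx.
  - by move=> n; apply: measurableT_comp => //; exact: measurable_funTS.
  - by move=> n x _; rewrite lee_fin.
  - by move=> x _ a b ab; rewrite lee_fin//; exact/lefP/nd_nnsfun_approx.
under eq_fun do rewrite integral_density_nnsfun.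
rewrite -monotone_convergence//=.
- apply: eq_integral => x xD; apply/cvg_lim => //=.
  by apply: cvgeZr => //; exact: cvg_nnsfun_approx.
- by move=> n; apply: emeasurable_funM; apply/measurable_EFinP.
- by move=> n x _; rewrite mule_ge0 ?lee_fin.
- move=> x _ a b ab; rewrite lee_wpmul2r ?lee_fin//; exact/lefP/nd_nnsfun_approx.
Qed.

End density.

Section words.
Context (R : realType) (I : finType).

(** Distributing an n-fold product of sums yields each word of length n once, so no multinomial
    coefficients arise. *)
Lemma sum_words (n : nat) (q : I -> R) :
  \sum_(t : n.-tuple I) \prod_(j <- t) q j = (\sum_j q j) ^+ n.
Proof.
rewrite -[n in RHS]card_ord -prodr_const (bigA_distr_bigA (fun _ j => q j)) /=.
rewrite (reindex (@tuple_of_finfun _ _)); last first.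
  exists (@finfun_of_tuple _ _) => t _; [exact: tuple_of_finfunK|exact: finfun_of_tupleK].
by apply: eq_bigr => f _; rewrite big_tuple; apply: eq_bigr => i _; rewrite tnth_mktuple.
Qed.

Lemma esum_words (a : seq I -> \bar R) : (forall s, (0 <= a s)%E) ->
  (\esum_(s in [set: seq I]) a s = \sum_(0 <= n <oo) \sum_(t : n.-tuple I) a t)%E.
Proof.
move=> a0.
rewrite (_ : [set: seq I] = \bigcup_(n in [set: nat]) [set s | size s = n]); last first.
  by apply/seteqP; split => // s _; exists (size s).
rewrite esum_bigcup //; last by move=> i j _ _ [s [/= <- <-]].
rewrite nneseries_esum; last by move=> n _; apply: sume_ge0.
rewrite (_ : [set x | _] = setT); last by apply/seteqP.
apply: eq_esum => n _.
rewrite (reindex_esum [set: n.-tuple I] _ (fun t : n.-tuple I => (t : seq I))).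
  rewrite esum_fset //; last exact: finite_finset.
  have -> : [set: n.-tuple I] = [set` index_enum (n.-tuple I)].
    by apply/seteqP; split => t _ //=; rewrite mem_index_enum.
  by rewrite -fsbig_seq // index_enum_uniq.
split.
- by move=> t _ /=; rewrite size_tuple.
- by move=> s t _ _ /val_inj.
- by move=> s /= /eqP sn; exists (Tuple sn).
Qed.

(** Numbers that code no element contribute 0, and a sum of nonnegative terms may be reindexed
    freely. *)
Lemma nneseries_pickle (J : countType) (a : J -> \bar R) : (forall s, (0 <= a s)%E) ->
  (\sum_(0 <= m <oo) oapp a 0 (pickle_inv m) = \esum_(s in [set: J]) a s)%E.
Proof.
move=> a0.
have b0 m : (0 <= oapp a 0 (@pickle_inv J m))%E by case: pickle_inv => /=.
rewrite (@eq_eseriesr _ _ (fun m =>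
    if isSome (@pickle_inv J m) then oapp a 0 (@pickle_inv J m) else 0)%E).
  rewrite -eseries_mkcond nneseries_esum; last by [].
  rewrite (reindex_esum [set: J] _ pickle).
    by apply: eq_esum => s _; rewrite pickleK_inv.
  split.
  - by move=> s _ /=; rewrite pickleK_inv.
  - by move=> s t _ _; exact: (pcan_inj (@pickleK_inv J)).
  - move=> m /=; case: (pickle_inv m) (@pickle_invK J m) => //= s sm _.
    by exists s.
by move=> m _; case: pickle_inv.
Qed.

End words.

(** Rewrites the power series as one series over nat, the numbering of the copies in [nat_copies].
    Convergence identifies the real limit in [gammaR] with the extended-real sum. *)
Lemma taylor_words (R : realType) (I : finType) (a : nat -> R) (q : I -> R) :
  (forall n, 0 <= a n) -> (forall j, 0 <= q j) ->
  cvgn (series (fun n => a n * (\sum_j q j) ^+ n)) ->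
  (\sum_(0 <= m <oo) (oapp (fun s : seq I => a (size s) * \prod_(j <- s) q j)
      0 (pickle_inv m))%:E = (gammaR a (\sum_j q j))%:E)%E.
Proof.
move=> a0 q0 ca.
have W0 (s : seq I) : (0 <= (a (size s) * \prod_(j <- s) q j)%:E)%E.
  by rewrite lee_fin mulr_ge0 // prodr_ge0.
transitivity (\sum_(0 <= m <oo) oapp (fun s : seq I => (a (size s) * \prod_(j <- s) q j)%:E)
    0 (pickle_inv m))%E.
  by apply: eq_eseriesr => m _; case: pickle_inv.
rewrite nneseries_pickle // esum_words // /gammaR -EFin_lim //; congr (limn _).
apply/funext => N /=; rewrite /series /= -sumEFin; apply: eq_bigr => n _.
rewrite sumEFin; congr EFin; rewrite -sum_words mulr_sumr; apply: eq_bigr => t _.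
by rewrite size_tuple.
Qed.

Section countable_sum.
Context (d : measure_display) (T : measurableType d) (R : realType).

(** The sigma-algebra on nat is discrete, so a preimage is a countable union of rectangles, one for
    each copy. *)
Lemma measurable_nat_prod (d' : measure_display) (T' : measurableType d') (f : nat * T -> T') :
  (forall m, measurable_fun setT (fun x => f (m, x))) -> measurable_fun setT f.
Proof.
move=> mf _ E mE; rewrite setTI.
rewrite (_ : f @^-1` E = \bigcup_m ([set m] `*` ((fun x => f (m, x)) @^-1` E))).
  apply: bigcup_measurable => m _; apply: measurableX => //.
  by rewrite -[X in measurable X]setTI; exact: mf.
apply/seteqP; split => [[m x] /= Ef|[m x] [m' _ [/= -> //]]].
by exists m.
Qed.

End countable_sum.

Section nat_copies.
Context (d : measure_display) (T : measurableType d) (R : realType).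
Context (w : {measure set T -> \bar R}).

(* The countable sum of copies of L^2(w) is realized as one L^2 space over
   [nat * T], so that a single completeness proof suffices. *)
Definition nat_copies : {measure set (nat * T) -> \bar R} :=
  mseries (fun m => mpush w (pair1_measurable m)) 0.

Lemma ge0_integral_nat_copies (f : nat * T -> \bar R) : measurable_fun setT f ->
  (forall p, 0 <= f p)%E ->
  (\int[nat_copies]_p f p = \sum_(0 <= m <oo) \int[w]_x f (m, x))%E.
Proof.
move=> mf f0; rewrite ge0_integral_measure_series //.
apply: eq_eseriesr => m _.
exact: (ge0_integral_pushforward (pair1_measurable m) w measurableT mf).
Qed.

Lemma nat_copies_preimage (phi : T -> T) (r : R) : 0 <= r ->
  measurable_fun setT phi ->
  (forall E, measurable E -> w (phi @^-1` E) = (r%:E * w E)%E) ->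
  forall E, measurable E ->
  nat_copies ((fun p => (p.1, phi p.2)) @^-1` E) = (r%:E * nat_copies E)%E.
Proof.
move=> r0 mphi wphi E mE.
rewrite -[LHS]/(\sum_(0 <= m <oo) w (phi @^-1` (pair m @^-1` E)))%E.
rewrite -[nat_copies E]/(\sum_(0 <= m <oo) w (pair m @^-1` E))%E.
rewrite -nneseriesZl; last by move=> m _; exact: measure_ge0.
apply: eq_eseriesr => m _; apply: wphi.
exact: (measurable_preimageT (pair1_measurable m) mE).
Qed.

End nat_copies.

(** * Construction of the normal extension *)

Unset Implicit Arguments.

Theorem theorem32 (R : realType) (k : nat) (a : nat -> R) (G : 'M[R]_k)
  (A : 'M[R]_k) (w mu : {measure set (k.-tuple R) -> \bar R}) :
  (0 < k)%N ->
  (forall n, 0 <= a n) ->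
  (exists n, (1 <= n)%N /\ 0 < a n) ->
  (forall r : R, 0 <= r -> cvgn (series (fun n => a n * r ^+ n))) ->
  is_inner_product G ->
  is_lebesgue_k w ->
  is_density_measure G a w mu ->
  A \in unitmx ->
  mx_normal G A ->
  CA_subnormal mu A.
Proof.
move=> _ a0 _ ca Gip wL muD Au An.
have [q [c [c0 q0 mq qsum qA]]] := normal_forms Gip Au An.
have [r r0 wA] := lebesgue_mxact wL Au.
pose W (s : seq 'I_k) x := a (size s) * \prod_(j <- s) q j x.
pose c_ (s : seq 'I_k) := \prod_(j <- s) c j.
have c_0 s : 0 < c_ s by exact: prodr_gt0.
have W0 s x : 0 <= W s x by rewrite mulr_ge0 // prodr_ge0.
have mW s : measurable_fun setT (W s).
  by apply: measurable_funM => //; exact: measurable_prod.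
(* Each letter j of the word contributes one factor c_j. *)
have WA s x : W s (mxact A x) = c_ s * W s x.
  rewrite /W /c_ mulrCA -big_split; congr (_ * _).
  by apply: eq_bigr => j _; rewrite qA.
pose Wn m x := oapp (W^~ x) 0 (@pickle_inv (seq 'I_k) m).
have Wn0 m x : 0 <= Wn m x by rewrite /Wn; case: pickle_inv => /=.
have mWn m : measurable_fun setT (Wn m).
  by rewrite /Wn; case: pickle_inv => [s|] /=; [exact: mW|exact: measurable_cst].
have Wn_sum x : (\sum_(0 <= m <oo) (Wn m x)%:E = (gammaR a (normG2 G x))%:E)%E.
  rewrite -qsum; apply: (taylor_words a0 (fun j => q0 j x)).
  by apply: ca; exact: sumr_ge0.
(* Codes [m] of no word carry weight [0]; there any positive factor will do. *)
pose bn m := oapp (fun s => Num.sqrt (c_ s)^-1) 1 (@pickle_inv (seq 'I_k) m).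
have bn0 m : 0 < bn m.
  by rewrite /bn; case: pickle_inv => //= s; rewrite sqrtr_gt0 invr_gt0.
(* The intertwining identity: the weight [bn] undoes the scaling of the square root of [Wn] under
   A. *)
have bnW m x : bn m * Num.sqrt (Wn m (mxact A x)) = Num.sqrt (Wn m x).
  rewrite /bn /Wn; case: pickle_inv => [s|] /=; last by rewrite sqrtr0 mulr0.
  by rewrite WA -sqrtrM ?invr_ge0 ?ltW // mulrA mulVf ?gt_eqF // mul1r.
pose gam x := gammaR a (normG2 G x).
have gam0 x : 0 <= gam x.
  by rewrite -lee_fin -Wn_sum; apply: nneseries_ge0 => m *; rewrite lee_fin.
(* Measurability of the density is read off from its expansion into weights. *)
have mgam : measurable_fun setT gam.
  apply/measurable_EFinP; rewrite (_ : _ \o _ = fun x => \sum_(0 <= m <oo) (Wn m x)%:E)%E.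
    apply: (ge0_emeasurable_sum (P := xpredT)) => [m x _ _|m _]; first by rewrite lee_fin.
    exact/measurable_EFinP.
  by apply/funext => x; rewrite Wn_sum.
pose nu := nat_copies w.
pose phi (p : nat * k.-tuple R) := (p.1, mxact A p.2).
pose psi (p : nat * k.-tuple R) := (p.1, mxact (invmx A) p.2).
have mphi : measurable_fun setT phi.
  apply: measurable_fun_pair => //.
  exact: (measurableT_comp (measurable_mxact A) measurable_snd).
have mpsi : measurable_fun setT psi.
  apply: measurable_fun_pair => //.
  exact: (measurableT_comp (measurable_mxact (invmx A)) measurable_snd).
have phiK : cancel phi psi by move=> [m x]; rewrite /psi /phi /= mxactK // mulVmx.
have psiK : cancel psi phi by move=> [m x]; rewrite /psi /phi /= mxactK // mulmxV.
have nuphi E : measurable E -> nu (phi @^-1` E) = (r%:E * nu E)%E.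
  by apply: nat_copies_preimage => //; [exact: ltW|exact: measurable_mxact].
pose b (p : nat * k.-tuple R) := bn p.1.
have mb : measurable_fun setT b.
  by apply: measurable_nat_prod => m; exact: (measurable_cst (bn m)).
have b0 p : 0 < b p by exact: bn0.
have bphi p : b (phi p) = b p by [].
have [K [ip [pi [rho [hK [Lrho pirho] pilin pieq ippi]]]]] := L2_hilbert nu.
pose lift (f : k.-tuple R -> complex R) (p : nat * k.-tuple R) :=
  (Num.sqrt (Wn p.1 p.2))%:C%C * f p.2.
have mlift f : cmeasurable f -> cmeasurable (lift f).
  move=> [rf jf]; apply: (cmeasurable_rmul (b := fun p => Num.sqrt (Wn p.1 p.2))).
    apply: measurable_nat_prod => m /=.
    apply: (measurableT_comp (continuous_measurable_fun _) (mWn m)).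
    exact: sqrt_continuous.
  split; first exact: (measurableT_comp rf measurable_snd).
  exact: (measurableT_comp jf measurable_snd).
(* The isometry: summing |f|^2 times the weights over all copies restores the density of [mu]. *)
have int_lift f : cmeasurable f ->
    (\int[nu]_p (cabs2 (lift f p))%:E = \int[mu]_x (cabs2 (f x))%:E)%E.
  move=> mf; rewrite ge0_integral_nat_copies; last 2 first.
  - exact: measurable_cabs2E (mlift _ mf).
  - by move=> p; rewrite lee_fin cabs2_ge0.
  rewrite (ge0_integral_density mgam gam0 muD); last 2 first.
  - exact: measurable_cabs2E.
  - by move=> x; rewrite lee_fin cabs2_ge0.
  rewrite -integral_nneseries //; last 2 first.
  - move=> m; have := measurable_cabs2E (mlift _ mf).
    exact: measurable_fun_pair2.
  - by move=> m x _; rewrite lee_fin cabs2_ge0.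
  apply: eq_integral => x _; rewrite -Wn_sum -nneseriesZl; last by move=> m _; rewrite lee_fin.
  apply: eq_eseriesr => m _.
  by rewrite /lift cabs2M cabs2_real /= sqr_sqrtr // EFinM muleC.
have Llift f : L2 mu f -> L2c nu (lift f).
  move=> Lf; have mf : cmeasurable f by exact: (L2c_cmeasurable Lf).
  have [rl il] := mlift _ mf; split => //; split => //.
  by rewrite int_lift //; case: Lf => _ [].
have lift_lin (z : complex R) f g :
    lift (fun x => z * f x + g x) = fun p => z * lift f p + lift g p.
  by apply/funext => p; rewrite /lift; ring.
have wlift f : wcomp phi b (lift f) = lift (f \o mxact A).
  apply/funext => -[m x]; rewrite /wcomp /lift /= mulrA -rmorphM /b /=.
  by rewrite bnW.
exists K, ip, (pi \o lift), (wdom nu b rho), (wop phi b pi rho).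
split; [exact: hK|split; [|split; [|split]]].
- by move=> z f g Lf Lg; rewrite /= lift_lin pilin //; exact: Llift.
- move=> f Lf; rewrite /= (hnorm2_pi ippi); last exact: Llift.
  exact: int_lift (L2c_cmeasurable Lf).
- exact: (wop_normal mphi mpsi phiK psiK r0 nuphi mb b0 bphi hK Lrho pirho pilin pieq ippi).
- move=> f [Lf LfA].
  (* [lift f] is in the domain because its weighted composition is the lift of f o A, which is in
     L^2(mu) by assumption. *)
  have Lb : L2c nu (fun p => (b p)%:C%C * lift f p).
    apply/(L2c_wcomp mphi mpsi phiK psiK r0 nuphi bphi).
    by rewrite wlift; exact: Llift.
  split; first by apply/(wdom_pi mb Lrho pirho pieq) => //; exact: Llift.
  rewrite /= (wop_pi mphi mpsi phiK psiK r0 nuphi mb bphi Lrho pirho pieq) ?wlift //.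
  exact: Llift.
Qed.
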